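(* Fix $m,n\in\mathbb{N}$, $p\in(0,2]$, let $\mu$ be an isotropic Borel measure on the unit sphere $S^{m-1}$ of $\mathbb{R}^m$ and let $X=X_p(\mu)$ (an $m$-dimensional subspace of $L_p$ whose unit ball is in Lewis' position). For a unit vector $a$ in $\mathbb{R}^n$, let $G_a$ be a standard Gaussian random vector on the subspace $H_a$ of $\mathbb{R}^{mn}$. Then for every $\lambda\in(0,\infty)$ and all unit vectors $\theta=(\theta_1,\ldots,\theta_n)$ and $\phi=(\phi_1,\ldots,\phi_n)$ in $\mathbb{R}^n$, we have $$(\theta_1^2,\ldots,\theta_n^2) \preceq (\phi_1^2,\ldots,\phi_n^2) \ \Longrightarrow\ \mathbb{E}\, e^{-\lambda \|G_\theta\|^p_{\ell_p^n(X)\cap H_\theta}} \leq \mathbb{E}\, e^{-\lambda \|G_\phi\|^p_{\ell_p^n(X)\cap H_\phi}}.$$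
   Context: A Borel measure $\mu$ on $S^{m-1}$ is isotropic if $\|x\|_2=\big(\int_{S^{m-1}}\langle x,u\rangle^2\,d\mu(u)\big)^{1/2}$ for every $x\in\mathbb{R}^m$. For $p\in(0,\infty)$ and such $\mu$, $X_p(\mu)=(\mathbb{R}^m,\|\cdot\|_{p,\mu})$ with $\|x\|_{p,\mu}=\big(\int_{S^{m-1}}|\langle x,u\rangle|^p\,d\mu(u)\big)^{1/p}$; a space $X=(\mathbb{R}^m,\|\cdot\|_X)$ of this form is said to have unit ball in Lewis' position. For a unit vector (Euclidean norm) $a\in\mathbb{R}^n$, $H_a=\{(x_1,\ldots,x_n)\in(\mathbb{R}^m)^n:\ \sum_{i=1}^n a_i x_i=0\}$, with the Euclidean structure induced from $\mathbb{R}^{mn}$; the standard Gaussian vector on $H_a$ is the one with respect to this structure. $\|\cdot\|_{\ell_p^n(X)\cap H_a}$ is the restriction to $H_a$ of the quasi-norm $\|(x_1,\ldots,x_n)\|_{\ell_p^n(X)}=\big(\sum_{i=1}^n\|x_i\|_X^p\big)^{1/p}$. Majorization: for $\alpha,\beta\in\mathbb{R}^n$ with nonincreasing rearrangements $\alpha_1^*\geq\cdots\geq\alpha_n^*$ and $\beta_1^*\geq\cdots\geq\beta_n^*$, $\alpha\preceq\beta$ means $\sum_{j=1}^k\alpha_j^*\leq\sum_{j=1}^k\beta_j^*$ for every $k\in\{1,\ldots,n-1\}$ and $\sum_{j=1}^n\alpha_j=\sum_{j=1}^n\beta_j$. *)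

(* Defs.v *)
From HB Require Import structures.
From mathcomp Require Import all_boot all_order all_algebra.
From mathcomp Require Import all_classical all_reals all_analysis.

Set Implicit Arguments.
Unset Strict Implicit.
Unset Printing Implicit Defensive.

Import Order.TTheory GRing.Theory Num.Theory.
Import numFieldNormedType.Exports.

Local Open Scope classical_set_scope.
Local Open Scope ring_scope.

(* R^m is 'rV[R]_m and (R^m)^n is 'M[R]_(n, m), the i-th
   component x_i being [row i x]. *)

(* One inner product serves both R^m = 'M_(1, m) and R^(mn) = 'M_(n, m). The
   library's norm `|x| on matrices is the sup norm, hence [norm2]. *)
Definition dot (R : realType) (k l : nat) (x y : 'M[R]_(k, l)) : R :=
  \sum_(i < k) \sum_(j < l) x i j * y i j.

Definition norm2 (R : realType) (k l : nat) (x : 'M[R]_(k, l)) : R :=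
  Num.sqrt (dot x x).

Definition sphere (R : realType) (m : nat) : set 'rV[R]_m :=
  [set u | norm2 u = 1].
Arguments sphere : clear implicits.

(* R^m with its Borel sigma-algebra. *)
Definition borelRV (R : realType) (m : nat) :=
  g_sigma_algebraType (@open 'rV[R]_m).

(* Borel measures on the sphere are encoded as the Borel measures on R^m that
   vanish outside of it. *)
Definition on_sphere (R : realType) (m : nat)
    (mu : {measure set (borelRV R m) -> \bar R}) : Prop :=
  mu (~` sphere R m) = 0%E.

Definition isotropic (R : realType) (m : nat)
    (mu : {measure set (borelRV R m) -> \bar R}) : Prop :=
  forall x : 'rV[R]_m,
    (norm2 x)%:E
      = ((\int[mu]_(u in sphere R m) ((dot x u) ^+ 2)%:E) `^ (2^-1))%E.

(* The quasi-norm of X_p(mu); the integral is finite when mu is isotropic and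
   0 < p, so [fine] loses nothing. *)
Definition Xnorm (R : realType) (m : nat) (p : R)
    (mu : {measure set (borelRV R m) -> \bar R}) (x : 'rV[R]_m) : R :=
  (fine (\int[mu]_(u in sphere R m) (`|dot x u| `^ p)%:E)%E) `^ (p^-1).

Definition lpnorm (R : realType) (m n : nat) (p : R) (N : 'rV[R]_m -> R)
    (x : 'M[R]_(n, m)) : R :=
  (\sum_(i < n) (N (row i x)) `^ p) `^ (p^-1).

Definition Hsub (R : realType) (m n : nat) (a : 'rV[R]_n) :
    set 'M[R]_(n, m) :=
  [set x | \sum_(i < n) a 0 i *: row i x = 0].
Arguments Hsub {R} m {n} a.

Definition orthonormal_basis (R : realType) (m n k : nat)
    (H : set 'M[R]_(n, m)) (e : 'I_k -> 'M[R]_(n, m)) : Prop :=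
  [/\ forall i, H (e i),
      forall i j, dot (e i) (e j) = (i == j)%:R &
      forall x, H x -> exists c : 'I_k -> R, x = \sum_(i < k) c i *: e i].

Definition mutually_independent (R : realType) (d : measure_display)
    (T : measurableType d) (P : probability T R) (k : nat)
    (g : 'I_k -> {RV P >-> R}) : Prop :=
  forall (J : {set 'I_k}) (B : 'I_k -> set R),
    (forall i, measurable (B i)) ->
    P (\bigcap_(i in [set` J]) (g i @^-1` B i))
      = (\prod_(i in J) P (g i @^-1` B i))%E.

Definition standard_normal (R : realType) (d : measure_display)
    (T : measurableType d) (P : probability T R) (g : {RV P >-> R}) : Prop :=
  forall B : set R, measurable B -> P (g @^-1` B) = normal_prob 0 1 B.

(* Standard Gaussian vector on a linear subspace H of R^(mn): independent
   standard normal coordinates in an orthonormal basis of H. By rotation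
   invariance the choice of the basis does not matter. *)
Definition standard_gaussian (R : realType) (d : measure_display)
    (T : measurableType d) (P : probability T R) (m n : nat)
    (H : set 'M[R]_(n, m)) (G : T -> 'M[R]_(n, m)) : Prop :=
  exists (k : nat) (e : 'I_k -> 'M[R]_(n, m)) (g : 'I_k -> {RV P >-> R}),
    [/\ orthonormal_basis H e,
        mutually_independent g,
        forall i, standard_normal (g i) &
        forall w, G w = \sum_(i < k) g i w *: e i].

Definition rearr (R : realType) (n : nat) (x : 'rV[R]_n) : seq R :=
  sort >=%R [seq x 0 i | i <- enum 'I_n].

(* 0-based indices: the j-th largest entry of x is nth 0 (rearr x) j.-1. *)
Definition majorized (R : realType) (n : nat) (x y : 'rV[R]_n) : Prop :=
  (forall k : nat, (1 <= k <= n.-1)%N ->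
     \sum_(0 <= j < k) nth 0 (rearr x) j <= \sum_(0 <= j < k) nth 0 (rearr y) j)
  /\ \sum_(i < n) x 0 i = \sum_(i < n) y 0 i.

(* Main.v *)
Require Import Defs.
From HB Require Import structures.
From mathcomp Require Import all_boot all_order all_algebra.
From mathcomp Require Import all_classical all_reals all_analysis.
From mathcomp Require Import measurable_realfun random_variable.
From mathcomp Require Import normal_distribution.
From mathcomp Require Import ring lra.

(* Write [q_A x = <A x, x>]. If the weight [f x = exp (- lambda |x|^p)] is a
   mixture of Gaussians [exp (- q_A x)], then E [prod_i f (G_i)] is a mixture,
   over independent choices [A_1, ..., A_n] with the same law, of
     E exp (- sum_i q_(A_i) (G_i))
       = prod_i det(B_i)^(-1/2) * det(sum_i a_i^2 B_i^-1)^(-1/2)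
   where [B_i = 1 + 2 A_i]. The last factor is itself
   E exp ((|g|^2 - sum_i a_i^2 q_(B_i^-1) (g)) / 2) for a standard Gaussian [g]
   on R^m, so that the whole mixture is E [exp (|g|^2 / 2) prod_i h_g (a_i^2)]
   with [h_g] a positive combination of exponentials. As [h_g] is log-convex,
   Karamata's inequality applies pointwise in [g].

   Instead of constructing the mixing law (a stable subordinator), the
   inequality is proved for finite mixtures, and [f] is reached from these by
   successive bounded pointwise limits: [s^alpha] is a limit of positive
   combinations of [1 - exp (- t s)], each of which gives a compound Poisson
   exponent, and the integral over the sphere is a limit of finite sums. *)

Set Implicit Arguments.
Unset Strict Implicit.
Unset Printing Implicit Defensive.

Import Order.TTheory GRing.Theory Num.Theory.
Import numFieldNormedType.Exports.

Local Open Scope classical_set_scope.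
Local Open Scope ring_scope.

(** * Determinants and quadratic forms *)

Lemma det_mxdiag (R : comNzRingType) (n : nat) (d : 'I_n -> nat)
    (B : forall i, 'M[R]_(d i)) :
  \det (\mxdiag_i B i) = \prod_i \det (B i).
Proof.
elim: n d B => [|n IH] d B.
  have -> : \mxdiag_i B i = 1%:M by apply/mxblockP => -[].
  by rewrite det1 big_ord0.
have det_cast k l (e : k = l) (M : 'M[R]_k) : \det (castmx (e, e) M) = \det M.
  by case: l / e; rewrite castmx_id.
by rewrite mxdiag_recl [RHS]big_ord_recl -IH det_cast det_ublock.
Qed.

(** Both sides are the determinant of the block matrix with rows [(1, X)] and [(- Y, 1)], factored
    into block triangular matrices in two ways. *)
Lemma sylvester_determinant (R : comNzRingType) (k l : nat)
    (X : 'M[R]_(k, l)) (Y : 'M[R]_(l, k)) :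
  \det (1%:M + X *m Y) = \det (1%:M + Y *m X).
Proof.
have e1 : block_mx 1%:M X (- Y) 1%:M
    = block_mx 1%:M 0 (- Y) 1%:M *m block_mx 1%:M X 0 (1%:M + Y *m X).
  rewrite mulmx_block !(mul1mx, mulmx1, mul0mx, mulmx0, addr0).
  by rewrite mulNmx addrC addrK.
have e2 : block_mx 1%:M X (- Y) 1%:M
    = block_mx (1%:M + X *m Y) X 0 1%:M *m block_mx 1%:M 0 (- Y) 1%:M.
  rewrite mulmx_block !(mul1mx, mulmx1, mul0mx, mulmx0, addr0, add0r).
  by rewrite mulmxN addrK.
have := congr1 (@determinant _ _) e1.
by rewrite e2 !det_mulmx !det_lblock !det_ublock !det1 !mulr1 !mul1r.
Qed.

(* The blocks [E i] of an isometry onto the orthogonal complement of the rows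
   [(a_1 1, ..., a_n 1)]: the compression of [diag (B_1, ..., B_n)] to it. *)
Lemma det_compression (R : comUnitRingType) (n m k : nat)
    (a : 'I_n -> R) (E : 'I_n -> 'M[R]_(k, m)) (B : 'I_n -> 'M[R]_m) :
  \sum_i a i ^+ 2 = 1 ->
  \sum_i E i *m (E i)^T = 1%:M ->
  (forall i j, (E i)^T *m E j = ((i == j)%:R - a i * a j)%:M) ->
  (forall i, B i \in unitmx) ->
  \det (\sum_i E i *m B i *m (E i)^T)
    = (\prod_i \det (B i)) * \det (\sum_i a i ^+ 2 *: invmx (B i)).
Proof.
move=> a1 EET ETE Bu.
pose D := \mxdiag_i B i; pose D' := \mxdiag_i invmx (B i).
pose F := \mxrow_i E i; pose N := \mxrow_i (a i)%:M : 'M[R]_(m, _).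
have DD' : D *m D' = 1%:M.
  rewrite /D' /mxdiag mul_mxdiag_mxblock -[1%:M]mxdiagZ /mxdiag.
  apply: eq_mxblock => i j; case: eqVneq => _; last by rewrite mulmx0.
  by rewrite !conform_mx_id mulmxV.
have NT : N^T = \mxcol_i (a i)%:M.
  by rewrite tr_mxrow; apply: eq_mxcol => i; rewrite tr_scalar_mx.
have FT : F^T *m F = 1%:M - N^T *m N.
  rewrite tr_mxrow mul_mxcol_mxrow NT mul_mxcol_mxrow -[1%:M]mxdiagZ /mxdiag.
  rewrite -mxblockB; apply: eq_mxblock => i j; rewrite ETE -scalar_mxM.
  rewrite raddfB /=; congr (_ - _); case: eqVneq => _.
    by rewrite conform_mx_id.
  by rewrite raddf0.
have NNT : N *m N^T = 1%:M.
  rewrite NT mul_mxrow_mxcol; under eq_bigr do rewrite -scalar_mxM -expr2.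
  by rewrite -a1 raddf_sum.
have FFT : F *m F^T = 1%:M by rewrite tr_mxrow mul_mxrow_mxcol.
(* Since [F *m F^T = 1], the compression of [D] is the identity plus the compression of [D - 1], the
   shape to which Sylvester's identity applies. *)
have -> : \sum_i E i *m B i *m (E i)^T = 1%:M + F *m ((D - 1%:M) *m F^T).
  rewrite mulmxBl mulmxBr mul1mx FFT addrC subrK mulmxA tr_mxrow.
  by rewrite mul_mxrow_mxdiag mul_mxrow_mxcol.
rewrite sylvester_determinant -mulmxA FT.
(* Factoring out [D] leaves a perturbation of the identity through the [m] rows of [N]; a second use
   of Sylvester's identity brings it down to size [m]. *)
have -> : 1%:M + (D - 1%:M) *m (1%:M - N^T *m N)
    = D *m (1%:M + (D' - 1%:M) *m N^T *m N).
  rewrite -mulmxA; move: (N^T *m N) => P.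
  rewrite mulmxBl !mulmxBr [RHS]mulmxDr (mulmxBl D') mulmxBr.
  rewrite mulmxA DD' !mulmx1 !mul1mx.
  by rewrite opprB [LHS]addrC addrA subrK -addrA (addrC (- _)).
rewrite det_mulmx det_mxdiag; congr (_ * _).
rewrite sylvester_determinant mulmxA mulmxBr mulmx1 mulmxBl NNT addrC subrK.
rewrite NT mul_mxrow_mxdiag mul_mxrow_mxcol; congr (\det _).
apply: eq_bigr => i _.
by rewrite mul_scalar_mx mul_mx_scalar scalerA expr2.
Qed.

Definition qform (R : pzRingType) (k : nat) (M : 'M[R]_k) (x : 'rV[R]_k) : R :=
  (x *m M *m x^T) 0 0.

Definition posdef (R : numDomainType) (k : nat) (M : 'M[R]_k) : Prop :=
  M^T = M /\ forall x, x != 0 -> 0 < qform M x.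

Section QuadraticForms.
Variable R : realFieldType.

Lemma qformD k (M N : 'M[R]_k) x : qform (M + N) x = qform M x + qform N x.
Proof. by rewrite /qform mulmxDr mulmxDl mxE. Qed.

Lemma qformZ k c (M : 'M[R]_k) x : qform (c *: M) x = c * qform M x.
Proof. by rewrite /qform -scalemxAr -scalemxAl mxE. Qed.

Lemma qform_sum (I : finType) k (M : I -> 'M[R]_k) x :
  qform (\sum_i M i) x = \sum_i qform (M i) x.
Proof. by rewrite /qform mulmx_sumr mulmx_suml summxE. Qed.

Lemma qform_comp k l (E : 'M[R]_(k, l)) (M : 'M[R]_l) x :
  qform (E *m M *m E^T) x = qform M (x *m E).
Proof. by rewrite /qform trmx_mul !mulmxA. Qed.

Lemma qformE k (M : 'M[R]_k) x :
  qform M x = \sum_i \sum_j x 0 i * M i j * x 0 j.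
Proof.
rewrite /qform mxE exchange_big; apply: eq_bigr => j _.
by rewrite !mxE mulr_suml.
Qed.

Lemma qform1 k (x : 'rV[R]_k) : qform 1%:M x = \sum_i x 0 i ^+ 2.
Proof. by rewrite /qform mulmx1 mxE; apply: eq_bigr => i _; rewrite mxE expr2. Qed.

Lemma qform1_ge0 k (x : 'rV[R]_k) : 0 <= qform 1%:M x.
Proof. by rewrite qform1 sumr_ge0 // => i _; rewrite sqr_ge0. Qed.

Lemma qform1_gt0 k (x : 'rV[R]_k) : x != 0 -> 0 < qform 1%:M x.
Proof.
move=> x0; rewrite lt_def qform1_ge0 andbT; apply: contra x0.
rewrite qform1 psumr_eq0 => [/allP h|i _]; last exact: sqr_ge0.
apply/eqP/rowP => i; rewrite mxE; apply/eqP.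
by have := h i (mem_index_enum _); rewrite sqrf_eq0.
Qed.

Lemma qform_outer k (v x : 'rV[R]_k) :
  qform (v^T *m v) x = ((x *m v^T) 0 0) ^+ 2.
Proof.
rewrite /qform mulmxA -mulmxA mxE big_ord1 expr2; congr (_ * _).
by rewrite !mxE; apply: eq_bigr => i _; rewrite !mxE mulrC.
Qed.

Lemma posdef_unit k (M : 'M[R]_k) : posdef M -> M \in unitmx.
Proof.
move=> [_ Mp]; rewrite -row_free_unit -kermx_eq0; apply/rowV0P => x /sub_kermxP xM.
apply/eqP; apply: contraT => /Mp; by rewrite /qform xM mul0mx mxE ltxx.
Qed.

Lemma posdef_inv k (M : 'M[R]_k) : posdef M -> posdef (invmx M).
Proof.
move=> pM; have Mu := posdef_unit pM; have [sM Mp] := pM.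
split=> [|x x0]; first by rewrite trmx_inv sM.
have -> : qform (invmx M) x = qform M (x *m invmx M).
  by rewrite /qform mulmxKV // trmx_mul trmx_inv sM mulmxA.
apply: Mp; apply: contra x0 => /eqP /(congr1 (mulmx^~ M)).
by rewrite mulmxKV // mul0mx => ->.
Qed.

Lemma posdef_comb (I : finType) k (t : I -> R) (M : I -> 'M[R]_k) :
  (forall i, 0 <= t i) -> 0 < \sum_i t i -> (forall i, posdef (M i)) ->
  posdef (\sum_i t i *: M i).
Proof.
move=> t0 st Mp; split=> [|x x0].
  rewrite linear_sum; apply: eq_bigr => i _.
  by rewrite linearZ /=; congr (_ *: _); case: (Mp i).
rewrite qform_sum lt_def sumr_ge0 ?andbT => [|i _]; last first.
  by rewrite qformZ mulr_ge0 // ltW // (Mp i).2.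
apply: contraTN st; rewrite psumr_eq0 => [/allP h|i _]; last first.
  by rewrite qformZ mulr_ge0 // ltW // (Mp i).2.
rewrite -leNgt le_eqVlt big1 ?eqxx // => i _; apply/eqP.
have := h i (mem_index_enum _).
by rewrite implyTb qformZ mulf_eq0 (gt_eqF ((Mp i).2 _ x0)) orbF.
Qed.

(** The Schur complement of the top left entry: the form that remains in the other coordinates once
    the square in the first one is completed. *)
Definition schur k (M : 'M[R]_(1 + k)) : 'M[R]_k :=
  drsubmx M - (M 0 0)^-1 *: (dlsubmx M *m ursubmx M).

Lemma ulsubmx00 k (M : 'M[R]_(1 + k)) : ulsubmx M = (M 0 0)%:M.
Proof.
rewrite [LHS]mx11_scalar; congr _%:M; rewrite !mxE.
by congr (M _ _); apply/val_inj.
Qed.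

Lemma qform_schur k (M : 'M[R]_(1 + k)) (a : R) (z : 'rV[R]_k) :
  M^T = M -> M 0 0 != 0 ->
  qform M (row_mx a%:M z)
    = M 0 0 * (a + (z *m dlsubmx M) 0 0 / M 0 0) ^+ 2 + qform (schur M) z.
Proof.
move=> sM c0; have ur : ursubmx M = (dlsubmx M)^T by rewrite trmx_dlsub sM.
rewrite /schur qformD -scaleNr qformZ ur.
have -> : qform (dlsubmx M *m (dlsubmx M)^T) z = ((z *m dlsubmx M) 0 0) ^+ 2.
  by rewrite -{1}(trmxK (dlsubmx M)) qform_outer trmxK.
have e : qform M (row_mx a%:M z)
    = a * (M 0 0 * a + (z *m dlsubmx M) 0 0) + a * (z *m dlsubmx M) 0 0
      + qform (drsubmx M) z.
  rewrite /qform -{1}(submxK M) ulsubmx00 ur mul_row_block tr_row_mx mul_row_col.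
  rewrite tr_scalar_mx mul_mx_scalar mulmxDl !mul_scalar_mx -scalemxAl -trmx_mul.
  move: (z *m dlsubmx M) (z *m drsubmx M *m z^T) => b q.
  by rewrite !mxE eqxx mulr1n; ring.
by rewrite e; field.
Qed.

Lemma posdef_pivot k (M : 'M[R]_(1 + k)) : posdef M -> 0 < M 0 0.
Proof.
move=> [sM Mp].
have := Mp (row_mx 1%:M 0).
rewrite /qform -{1}(submxK M) mul_row_block tr_row_mx mul_row_col.
rewrite !trmx1 !trmx0 !mulmx0 !mul1mx !mul0mx !addr0 mulmx1 ulsubmx00 mxE mulr1n.
apply; apply/eqP => /(congr1 lsubmx); rewrite row_mxKl linear0 => /matrixP/(_ 0 0).
by rewrite !mxE => /eqP; rewrite oner_eq0.
Qed.

Lemma posdef_schur k (M : 'M[R]_(1 + k)) : posdef M -> posdef (schur M).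
Proof.
move=> pM; have c0 := posdef_pivot pM; have [sM Mp] := pM.
have ur : ursubmx M = (dlsubmx M)^T by rewrite trmx_dlsub sM.
split=> [|z z0].
  rewrite /schur linearB linearZ /= ur trmx_mul trmxK; congr (_ - _).
  by rewrite trmx_drsub sM.
(* The first coordinate is chosen so that the completed square vanishes. *)
have := Mp (row_mx (- ((z *m dlsubmx M) 0 0 / M 0 0))%:M z).
rewrite qform_schur ?gt_eqF // addNr expr0n mulr0 add0r; apply.
apply: contra z0 => /eqP /(congr1 rsubmx); rewrite row_mxKr linear0 => ->.
exact/eqP.
Qed.

Lemma det_schur k (M : 'M[R]_(1 + k)) :
  M 0 0 != 0 -> \det M = M 0 0 * \det (schur M).
Proof.
move=> c0.
have e : M = block_mx (M 0 0)%:M 0 (dlsubmx M) (schur M)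
             *m block_mx 1%:M ((M 0 0)^-1 *: ursubmx M) 0 1%:M.
  rewrite mulmx_block !(mul1mx, mulmx1, mul0mx, mulmx0, addr0, add0r).
  rewrite mul_scalar_mx scalerA divff // scale1r -scalemxAr addrC subrK.
  by rewrite -ulsubmx00 submxK.
by rewrite {1}e det_mulmx det_lblock det_ublock !det1 !mulr1 det_scalar1.
Qed.

Lemma posdef_det_gt0 k (M : 'M[R]_k) : posdef M -> 0 < \det M.
Proof.
elim: k M => [|k IH] M pM; first by rewrite det_mx00.
have c0 := posdef_pivot pM; rewrite (@det_schur k) ?gt_eqF //.
by rewrite mulr_gt0 // IH //; apply: posdef_schur.
Qed.

End QuadraticForms.

(** * Gaussian expectations of quadratic exponentials *)

Section OneDimensional.
Variable R : realType.

(** The change of variables produces an abstract Radon-Nikodym derivative; it agrees almost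
    everywhere with the Gaussian density because both have the same integral over every measurable
    set. *)
Lemma ge0_integral_normal (m s : R) (f : R -> \bar R) :
  measurable_fun [set: R] f -> (forall x, 0 <= f x)%E ->
  (\int[normal_prob m s]_x f x
    = \int[lebesgue_measure]_x (f x * (normal_pdf m s x)%:E))%E.
Proof.
move=> mf f0.
rewrite -(Radon_Nikodym_SigmaFinite.change_of_variables
  (@normal_prob_dominates R m s)) //.
have fi := Radon_Nikodym_SigmaFinite.f_integrable (@normal_prob_dominates R m s).
apply: ae_eq_integral => //.
- by apply: emeasurable_funM => //; apply: (measurable_int _ fi).
- apply: emeasurable_funM => //; apply/measurable_EFinP.
  exact: measurable_normal_pdf.
- apply: ae_eqe_mul2l => /=; apply: integral_ae_eq => //.
  + by apply/measurable_EFinP; exact: measurable_normal_pdf.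
  + move=> E _ mE; rewrite -Radon_Nikodym_SigmaFinite.f_integral //.
    exact: normal_prob_dominates.
Qed.

(** The term [2^-1 * x ^+ 2] cancels the exponent of the standard density, leaving [s = c^(-1/2)]
    times the density of mean [- b] and standard deviation [s]. *)
Lemma integral_normal_tilt (c b : R) : 0 < c ->
  (\int[normal_prob 0 1]_x
     (expR (2^-1 * x ^+ 2 - 2^-1 * (c * (x + b) ^+ 2)))%:E
   = ((Num.sqrt c)^-1)%:E)%E.
Proof.
move=> c0; pose s := (Num.sqrt c)^-1.
have s0 : 0 < s by rewrite invr_gt0 sqrtr_gt0.
have mf : measurable_fun [set: R]
    (fun x : R => expR (2^-1 * x ^+ 2 - 2^-1 * (c * (x + b) ^+ 2))).
  apply: measurableT_comp => //; apply: measurable_funB.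
    by apply: measurable_funM => //; exact: measurable_funX.
  apply: measurable_funM => //; apply: measurable_funM => //.
  by apply: measurable_funX; exact: measurable_funD.
rewrite ge0_integral_normal; first last.
- by move=> x; rewrite lee_fin expR_ge0.
- by apply/measurable_EFinP.
transitivity (\int[lebesgue_measure]_x (s%:E * (normal_pdf (- b) s x)%:E))%E.
  apply: eq_integral => x _; rewrite -!EFinM; congr (_%:E).
  rewrite !normal_pdfE ?oner_eq0 ?gt_eqF // /normal_peak /normal_fun.
  rewrite [LHS]mulrCA -expRD [RHS]mulrA; congr (_ * _).
    rewrite expr1n mul1r -mulrnAr sqrtrM ?sqr_ge0 // sqrtr_sqr gtr0_norm //.
    by rewrite invfM mulrA divff ?gt_eqF // mul1r.
  congr expR; have -> : s ^+ 2 = c^-1 by rewrite exprVn sqr_sqrtr ?ltW.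
  by field; rewrite gt_eqF.
rewrite ge0_integralZl_EFin ?ltW //; first last.
- by apply/measurable_EFinP; exact: measurable_normal_pdf.
- by move=> x _; rewrite lee_fin normal_pdf_ge0.
by rewrite integral_normal_pdf mule1.
Qed.

End OneDimensional.

(** * Integrating out one of several independent normal variables *)

Section Boxes.
Variables (R : realType) (k : nat).

Definition box (B : 'I_k -> set R) : set 'rV[R]_k :=
  [set z | forall i, B i (z 0 i)].

(** A family stable under intersection, generating the sigma-algebra used below on R^k; finite
    measures that agree on it are equal. *)
Definition boxes : set (set 'rV[R]_k) :=
  [set C | exists2 B : 'I_k -> set R,
     forall i, measurable (B i) & C = box B].

Lemma boxes_setI_closed : setI_closed boxes.
Proof.
move=> _ _ [B mB ->] [C mC ->]; exists (fun i => B i `&` C i).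
  by move=> i; apply: measurableI.
by apply/seteqP; split=> [z [zB zC] i|z zBC]; [|split=> i; case: (zBC i)].
Qed.

Lemma boxes_setT : boxes setT.
Proof. by exists (fun=> setT) => //; apply/seteqP; split. Qed.

Lemma measurable_coord (i : 'I_k) :
  measurable_fun setT (fun z : g_sigma_algebraType boxes => (z : 'rV[R]_k) 0 i).
Proof.
move=> _ B mB; rewrite setTI; apply: sub_sigma_algebra.
exists (fun j => if j == i then B else setT).
  by move=> j; case: ifP.
apply/seteqP; split=> [z /= zB j|z /(_ i)]; last by rewrite eqxx.
by case: eqP => [->|].
Qed.

End Boxes.

Section Peeling.
Context (R : realType) (d : measure_display) (T : measurableType d).
Variables (P : probability T R) (k : nat) (g : 'I_k.+1 -> {RV P >-> R}).
Hypotheses (g_indep : mutually_independent g)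
  (g_normal : forall i, standard_normal (g i)).

Let Z (w : T) : g_sigma_algebraType (@boxes R k) :=
  \row_i g (lift ord0 i) w.

Let mZ : measurable_fun setT Z.
Proof.
apply: (@measurability _ _ _ (g_sigma_algebraType (@boxes R k)) setT Z
  (@boxes R k)) => // _ [_ [B mB ->] <-].
rewrite setTI (_ : _ @^-1` _ = \bigcap_(i in setT) (g (lift ord0 i) @^-1` B i)).
  apply: fin_bigcap_measurable => // i _; apply: measurable_funPTI.
  exact: mB.
apply/seteqP; split=> [w /= wB i _|w /= wB i]; first by have := wB i; rewrite mxE.
by rewrite mxE; apply: wB.
Qed.

Let gZ (w : T) : measurableTypeR R * g_sigma_algebraType (@boxes R k) :=
  (g ord0 w, Z w).

Let mgZ : measurable_fun setT gZ.
Proof.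
apply: measurable_fun_pair => //; exact: (measurable_funPT (g ord0)).
Qed.

HB.instance Definition _ := isMeasurableFun.Build _ _ _ _ Z mZ.
HB.instance Definition _ := isMeasurableFun.Build _ _ _ _ gZ mgZ.

Let indep_box (A : set R) (B : 'I_k -> set R) : measurable A ->
  (forall i, measurable (B i)) ->
  P (g ord0 @^-1` A `&` Z @^-1` box B)
    = (P (g ord0 @^-1` A) * P (Z @^-1` box B))%E.
Proof.
move=> mA mB.
(* [C] puts [A] at index 0 and [B] at the others, so that both events become intersections to which
   [g_indep] applies. *)
pose C i := if unlift ord0 i is Some j then B j else A.
have mC i : measurable (C i) by rewrite /C; case: unliftP.
have C0 : C ord0 = A by rewrite /C unlift_none.
have Cl j : C (lift ord0 j) = B j by rewrite /C liftK.
have ZE : Z @^-1` box B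
    = \bigcap_(i in [set` [set i : 'I_k.+1 | i != ord0]%SET]) (g i @^-1` C i).
  apply/seteqP; split=> w /= h.
    move=> i /=; rewrite !inE; case: (unliftP ord0 i) => [j ->|->]; last by rewrite eqxx.
    by move=> _; rewrite Cl; have := h j; rewrite mxE.
  move=> j; have := h (lift ord0 j); rewrite /= !inE mxE Cl; apply.
  by rewrite eq_sym neq_lift.
have gZE : g ord0 @^-1` A `&` Z @^-1` box B
    = \bigcap_(i in [set` [set: 'I_k.+1]%SET]) (g i @^-1` C i).
  rewrite ZE; apply/seteqP; split=> w /=.
    move=> [h0 h] i _; case: (eqVneq i ord0) => [->|i0]; first by rewrite C0.
    by apply: h; rewrite /= !inE.
  move=> h; split; first by rewrite -C0; apply: h; rewrite /= inE.
  by move=> i _; apply: h; rewrite /= inE.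
rewrite gZE ZE !g_indep // (bigD1 ord0) ?inE //= C0; congr (_ * _)%E.
by apply: eq_bigl => i; rewrite !inE.
Qed.

(** For fixed [A], both sides are finite measures in [B] that agree on boxes by [indep_box], hence
    everywhere. *)
Let indep_pair (A : set R) (B : set (g_sigma_algebraType (@boxes R k))) :
  measurable A -> measurable B ->
  P (g ord0 @^-1` A `&` Z @^-1` B) = (P (g ord0 @^-1` A) * P (Z @^-1` B))%E.
Proof.
move=> mA mB.
have mgA : measurable (g ord0 @^-1` A) by apply: measurable_funPTI.
pose r := NngNum (fine_ge0 (measure_ge0 P (g ord0 @^-1` A))).
have covT : \bigcup_(n : nat) [set: g_sigma_algebraType (@boxes R k)] = setT.
  by apply: bigcup_const; exists 0%N.
have := @measure_unique _ R (g_sigma_algebraType (@boxes R k))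
  (@boxes R k) (fun=> setT) erefl
  (@boxes_setI_closed R k) (fun=> @boxes_setT R k)  covT
  (pushforward (mrestr P mgA) Z) (mscale r (distribution P Z)).
move=> /(_ mZ _ _ B mB).
have scaleE C : mscale r (distribution P Z) C
    = (P (g ord0 @^-1` A) * P (Z @^-1` C))%E.
  by rewrite /mscale /= fineK // fin_num_measure.
rewrite setIC -scaleE; apply => [_ [C mC ->]|_].
  by apply: etrans (esym (scaleE _)); rewrite -indep_box // setIC.
rewrite /pushforward /mrestr (le_lt_trans (probability_le1 _ _)) ?ltry //.
by apply: measurableI => //; rewrite -[X in measurable X]setTI; exact: mZ.
Qed.

(** By independence the law of [(g ord0, Z)] is the product of the standard normal law and the law
    of [Z]; Tonelli's theorem then integrates the first coordinate first. *)
Lemma peel_normal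
    (F : measurableTypeR R * g_sigma_algebraType (@boxes R k) -> \bar R) :
  measurable_fun setT F -> (forall x, 0 <= F x)%E ->
  (\int[P]_w F (g ord0 w, \row_i g (lift ord0 i) w)
    = \int[P]_w \int[normal_prob 0 1]_x F (x, \row_i g (lift ord0 i) w))%E.
Proof.
move=> mF F0.
transitivity (\int[distribution P gZ]_y F y)%E.
  by rewrite ge0_integral_distribution.
have NZ : forall A, measurable A ->
    distribution P gZ A = (normal_prob 0%R 1%R \x distribution P Z)%E A.
  move=> A mA.

  apply: esym; apply: product_measure_unique => // B C mB mC.
  by apply: etrans (indep_pair mB mC) _; congr (_ * _)%E; exact: g_normal.
rewrite (eq_measure_integral (normal_prob 0%R 1%R \x distribution P Z)%E); last first.
  by move=> A mA _; exact: NZ.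
rewrite fubini_tonelli2 //.
rewrite ge0_integral_distribution //; last 2 first.
  exact: measurable_fun_fubini_tonelli_G.
  by move=> y; apply: integral_ge0.
Qed.

End Peeling.

Lemma measurable_mulmx_row (R : realType) (k l : nat) (M : 'M[R]_(k, l))
    d (T : measurableType d) (Z : T -> 'rV[R]_k) (j : 'I_l) :
  (forall i, measurable_fun setT (fun w => Z w 0 i)) ->
  measurable_fun setT (fun w => (Z w *m M) 0 j).
Proof.
move=> mZ; under eq_fun do rewrite mxE.
by apply: measurable_sum => i; apply: measurable_funM.
Qed.

Lemma measurable_qform (R : realType) (k : nat) (M : 'M[R]_k)
    d (T : measurableType d) (Z : T -> 'rV[R]_k) :
  (forall i, measurable_fun setT (fun w => Z w 0 i)) ->
  measurable_fun setT (fun w => qform M (Z w)).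
Proof.
move=> mZ; rewrite /qform; under eq_fun do rewrite mxE.
apply: measurable_sum => i; under eq_fun do rewrite [_^T _ _]mxE.
by apply: measurable_funM => //; apply: measurable_mulmx_row.
Qed.

Lemma sub_mutually_independent (R : realType) (d : measure_display)
    (T : measurableType d) (P : probability T R) (k l : nat)
    (g : 'I_k -> {RV P >-> R}) (f : 'I_l -> 'I_k) :
  injective f -> mutually_independent g -> mutually_independent (g \o f).
Proof.
move=> fI gi J B mB.
(* [B] is transported along the injection [f], with the measurable default [setT] off its image. *)
pose C j := if [pick i | f i == j] is Some i then B i else setT.
have Cf i : C (f i) = B i.
  by rewrite /C; case: pickP => [j /eqP/fI ->|/(_ i)] //; rewrite eqxx.
have mC j : measurable (C j) by rewrite /C; case: pickP.
have := gi (f @: J)%SET C mC.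
rewrite (big_imset _ (in2W fI)) /=.
under eq_bigr do rewrite Cf; move=> <-; congr (P _).
apply/seteqP; split=> w /= h.
  by move=> _ /imsetP[i iJ ->]; rewrite Cf; apply: h.
by move=> i iJ; rewrite -Cf; apply: h; apply/imsetP; exists i.
Qed.

(** Induction on the dimension: completing the square in the first coordinate and integrating it out
    gives the factor [(M 0 0)^(-1/2)]. The Schur complement, again positive definite, governs the
    other coordinates, and the determinant factors accordingly. *)
Lemma expectation_gaussian_quadratic (R : realType) (k : nat) (M : 'M[R]_k)
    (d : measure_display) (T : measurableType d) (P : probability T R)
    (g : 'I_k -> {RV P >-> R}) :
  posdef M -> mutually_independent g -> (forall i, standard_normal (g i)) ->
  (\int[P]_w (expR (2^-1 * qform 1%:M (\row_i g i w)
                    - 2^-1 * qform M (\row_i g i w)))%:E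
    = ((Num.sqrt (\det M))^-1)%:E)%E.
Proof.
elim: k M g => [|k IH] M g pM gi gN.
  under eq_integral => w _ do rewrite !qformE !big_ord0 mulr0 subr0 expR0.
  transitivity (1%:E * P [set: T])%E; first exact: integral_cst.
  by rewrite probability_setT mule1 det_mx00 sqrtr1 invr1.
have c0 : 0 < M 0 0 := @posdef_pivot _ k M pM.
pose b (z : 'rV[R]_k) := (z *m @dlsubmx _ 1 k 1 k M) 0 0 / M 0 0.
pose c (z : 'rV[R]_k) :=
  expR (2^-1 * qform 1%:M z - 2^-1 * qform (@schur _ k M) z).
pose F (y : measurableTypeR R * g_sigma_algebraType (@boxes R k)) : \bar R :=
  (c y.2 * expR (2^-1 * (y.1 : R) ^+ 2
                 - 2^-1 * (M 0 0 * ((y.1 : R) + b y.2) ^+ 2)))%:E.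
have coord2 i : measurable_fun setT
    (fun y : measurableTypeR R * g_sigma_algebraType (@boxes R k) =>
       (y.2 : 'rV[R]_k) 0 i).
  exact: measurableT_comp (@measurable_coord R k i) measurable_snd.
have coord1 : measurable_fun setT
    (fun y : measurableTypeR R * g_sigma_algebraType (@boxes R k) => (y.1 : R)).
  exact: (@measurable_fst _ _ (measurableTypeR R)).
have mF : measurable_fun setT F.
  rewrite /F /c /b; apply/measurable_EFinP; apply: measurable_funM.
    apply: measurableT_comp => //; apply: measurable_funB;
    by apply: measurable_funM => //; exact: measurable_qform.
  apply: measurableT_comp => //; apply: measurable_funB.
    by apply: measurable_funM => //; exact: measurable_funX.
  apply: measurable_funM => //; apply: measurable_funM => //.
  apply: measurable_funX; apply: measurable_funD => //.
  by apply: measurable_funM => //; exact: measurable_mulmx_row.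
have F0 y : (0 <= F y)%E by rewrite lee_fin mulr_ge0 ?expR_ge0.
transitivity (\int[P]_w F (g ord0 w, (\row_i g (lift ord0 i) w)))%E.
  apply: eq_integral => w _; rewrite /F /c /b /= -expRD.
  have -> : \row_i g i w
      = row_mx (g ord0 w)%:M (\row_i g (lift ord0 i) w) :> 'rV_(1 + k).
    apply/rowP => i; rewrite !mxE; case: splitP => j.
      rewrite (ord1 j) !mxE eqxx mulr1n => e; congr (g _ w); exact/val_inj.
    by rewrite mxE => e; congr (g _ w); exact/val_inj.
  move: (\row_i g (lift ord0 i) w) (g ord0 w) => z x.
  rewrite (@qform_schur _ k M) ?gt_eqF //; last by case: pM.
  have -> : qform 1%:M (row_mx x%:M z) = x ^+ 2 + qform 1%:M z.
    rewrite /qform !mulmx1 tr_row_mx mul_row_col mxE tr_scalar_mx.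
    by rewrite -scalar_mxM mxE eqxx mulr1n expr2.
  by congr (expR _)%:E; ring.
rewrite peel_normal //.
transitivity (\int[P]_w (((Num.sqrt (M 0 0))^-1)%:E
    * (c (\row_i g (lift ord0 i) w))%:E))%E.
  apply: eq_integral => w _; rewrite /F /=.
  under eq_integral do rewrite EFinM.
  rewrite ge0_integralZl_EFin ?expR_ge0 //; first last.
  - apply/measurable_EFinP; apply: measurableT_comp => //; apply: measurable_funB.
      by apply: measurable_funM => //; exact: measurable_funX.
    apply: measurable_funM => //; apply: measurable_funM => //.
    by apply: measurable_funX; exact: measurable_funD.
  by rewrite integral_normal_tilt // muleC.
rewrite ge0_integralZl_EFin ?invr_ge0 ?sqrtr_ge0 //; first last.
- apply/measurable_EFinP; apply: measurableT_comp => //.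
  have mg i : measurable_fun setT (fun w => (\row_i g (lift ord0 i) w) 0 i).
    under eq_fun do rewrite mxE; exact: measurable_funPT.
  by apply: measurable_funB; apply: measurable_funM => //; exact: measurable_qform.
- by move=> w _; rewrite lee_fin expR_ge0.
have -> : \det M = M 0 0 * \det (@schur _ k M) by apply: det_schur; rewrite gt_eqF.
rewrite sqrtrM ?ltW // invfM EFinM.
congr (_ * _)%E; apply: (IH _ (g \o lift ord0)) => [||i].
- exact: posdef_schur.
- exact: sub_mutually_independent (@lift_inj _ ord0) gi.
- exact: gN.
Qed.

(** * Majorization *)

Section Karamata.
Variable R : realType.

(** Summation by parts: the right side minus the left is the sum over [k < n] of [c k - c k.+1]
    times the sum of [d 0, ..., d k]. *)
Lemma abel_ge (c d : nat -> R) (n : nat) :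
  (forall k, (k < n)%N -> c k.+1 <= c k) ->
  (forall k, (k <= n)%N -> 0 <= \sum_(0 <= j < k) d j) ->
  c n * \sum_(0 <= j < n.+1) d j <= \sum_(0 <= j < n.+1) c j * d j.
Proof.
elim: n => [|n IH] cn dn; first by rewrite !big_nat1.
rewrite big_nat_recr //= [leRHS]big_nat_recr //= mulrDr lerD2r.
apply: le_trans (IH _ _) => [|k kn|k kn].
- by apply: ler_wpM2r; [apply: dn|apply: cn].
- by apply: cn; apply: ltnW.
- by apply: dn; apply: leqW.
Qed.

Section LogConvex.
Variables (I : finType) (c r : I -> R).
Hypothesis c_ge0 : forall l, 0 <= c l.

Let h (t : R) := \sum_l c l * expR (- t * r l).
Let s (t : R) := - (\sum_l c l * r l * expR (- t * r l)) / h t.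

Let h_ge0 t : 0 <= h t.
Proof. by apply: sumr_ge0 => l _; rewrite mulr_ge0 ?expR_ge0. Qed.

(* [log h] is convex with slope [s]: [exp u >= 1 + u] for the deviations of the
   rates [- r l] from their weighted mean [s x]. *)
Let tangent x y : h x != 0 -> h x * expR (s x * (y - x)) <= h y.
Proof.
move=> hx0; rewrite {2}/h.
(* The deviations add nothing to the sum: [s x] is the mean of the [- r l] with weights
   [c l * expR (- x * r l)]. *)
have -> : h x * expR (s x * (y - x)) = \sum_l
    c l * expR (- x * r l) * expR (s x * (y - x)) * (1 + (- r l - s x) * (y - x)).
  have -> : h x * expR (s x * (y - x)) = expR (s x * (y - x)) * (h x
      + (y - x) * (- (\sum_l c l * r l * expR (- x * r l)) - s x * h x)).
    by rewrite divfK // subrr mulr0 addr0 mulrC.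
  rewrite /h -sumrN !mulr_sumr -sumrB mulr_sumr -big_split mulr_sumr /=.
  by apply: eq_bigr => l _; ring.
apply: ler_sum => l _; move: (s x) => u; rewrite -!mulrA; apply: ler_wpM2l => //.
have -> : expR (- y * r l) = expR (- x * r l)
    * (expR (u * (y - x)) * expR ((- r l - u) * (y - x))).
  by rewrite -!expRD; congr expR; ring.
by do 2 (apply: ler_wpM2l; first exact: expR_ge0); exact: expR_ge1Dx.
Qed.

(** Going from [x] to [y] and back by the two tangent inequalities gives
    [expR ((s x - s y) * (y - x)) <= 1]. *)
Let slope_le x y : h x != 0 -> h y != 0 -> x <= y -> s x <= s y.
Proof.
move=> hx0 hy0; rewrite le_eqVlt => /predU1P[-> //|xy].
have hx : 0 < h x by rewrite lt_def hx0 h_ge0.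
have := le_trans (ler_wpM2r (expR_ge0 (s y * (x - y))) (tangent y hx0))
  (tangent x hy0).
rewrite -mulrA -expRD ger_pMr // -expR0 ler_expR.
have -> : s x * (y - x) + s y * (x - y) = (s x - s y) * (y - x) by ring.
by rewrite pmulr_lle0 ?subr_gt0 // subr_le0.
Qed.

(** Karamata's inequality for [log h]: after sorting, the tangents at the entries of [x] reduce it
    to the nonnegativity of the sum of slopes times differences. The slopes decrease along the
    rearrangement and the differences have nonnegative partial sums and total 0, so [abel_ge]
    applies. *)
Lemma prod_sum_expR_majorized (n : nat) (x y : 'rV[R]_n) : majorized x y ->
  \prod_(i < n) h (x 0 i) <= \prod_(i < n) h (y 0 i).
Proof.
case: n x y => [|n] x y [xy_part xy_sum]; first by rewrite !big_ord0.
have perm_rearr (z : 'rV[R]_n.+1) :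
    perm_eq (rearr z) [seq z 0 i | i <- enum 'I_n.+1] by rewrite perm_sort.
have size_rearr z : size (@rearr R n.+1 z) = n.+1.
  by rewrite (perm_size (perm_rearr z)) size_map size_enum_ord.
have prodE (z : 'rV[R]_n.+1) : \prod_(i < n.+1) h (z 0 i)
    = \prod_(0 <= j < n.+1) h (nth 0 (rearr z) j).
  transitivity (\prod_(v <- rearr z) h v); last by rewrite (big_nth 0) size_rearr.
  by rewrite (perm_big _ (perm_rearr z)) big_map big_enum.
have sumE (z : 'rV[R]_n.+1) :
    \sum_(i < n.+1) z 0 i = \sum_(0 <= j < n.+1) nth 0 (rearr z) j.
  transitivity (\sum_(v <- rearr z) v); last by rewrite (big_nth 0) size_rearr.
  by rewrite (perm_big _ (perm_rearr z)) big_map big_enum.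
(* If all weights vanish then [h] is 0 and has no logarithmic slope; otherwise it is positive
   everywhere. *)
have [h0|hN0] := boolP [forall l, c l == 0].
  have hE t u : h t = h u.
    by rewrite /h !big1 // => l _; rewrite (eqP (forallP h0 l)) mul0r.
  by rewrite (eq_bigr (fun i => h (y 0 i))) // => i _; apply: hE.
have h_gt0 t : 0 < h t.
  move: hN0; rewrite negb_forall => /existsP[l cl0].
  rewrite /h (bigD1 l) //=; apply: ltr_pwDl.
    by rewrite mulr_gt0 ?expR_gt0 // lt_def cl0 c_ge0.
  by apply: sumr_ge0 => j _; rewrite mulr_ge0 ?expR_ge0.
have h_neq0 t : h t != 0 by rewrite gt_eqF.
rewrite !prodE; set xs := rearr x; set ys := rearr y.
pose d j := nth 0 ys j - nth 0 xs j.
have d_part k : (k <= n)%N -> 0 <= \sum_(0 <= j < k) d j.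
  case: k => [|k] kn; first by rewrite big_geq.
  by rewrite sumrB subr_ge0; apply: xy_part.
have d_sum : \sum_(0 <= j < n.+1) d j = 0.
  by rewrite sumrB -!sumE xy_sum subrr.
have s_mono k : (k < n)%N -> s (nth 0 xs k.+1) <= s (nth 0 xs k).
  move=> kn; apply: slope_le => //.
  have := @sort_sorted _ >=%R (fun u v => le_total v u)
    [seq x 0 i | i <- enum 'I_n.+1].
  by move=> /(sortedP 0) /(_ k); rewrite -/(rearr x) size_rearr ltnS; apply.
have := abel_ge s_mono d_part; rewrite d_sum mulr0 => s_ge0.
apply: (@le_trans _ _ (\prod_(0 <= j < n.+1)
    (h (nth 0 xs j) * expR (s (nth 0 xs j) * d j)))).
  rewrite big_split /= ler_peMr ?prodr_ge0 // -expR_sum -expR0 ler_expR //.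
by apply: ler_prod => j _; rewrite mulr_ge0 ?expR_ge0 //= tangent.
Qed.

End LogConvex.
End Karamata.

(** * Gaussian vectors on the subspaces *)

Lemma norm2_unit (R : realType) (n : nat) (a : 'rV[R]_n) :
  norm2 a = 1 -> \sum_i a 0 i ^+ 2 = 1.
Proof.
rewrite /norm2 /dot big_ord1; under eq_bigr do rewrite -expr2.
move=> a1; rewrite -[LHS]sqr_sqrtr ?a1 ?expr1n //.
by apply: sumr_ge0 => i _; apply: sqr_ge0.
Qed.

Section GaussianOnSubspace.
Context (R : realType) (n m : nat) (a : 'rV[R]_n).
Hypothesis a_unit : norm2 a = 1.
Variables (k : nat) (e : 'I_k -> 'M[R]_(n, m)).
Hypothesis e_onb : orthonormal_basis (Hsub m a) e.

(** Right multiplication by [E i] takes the coordinates of a point of the subspace in the basis [e]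
    to its [i]-th component. *)
Let E (i : 'I_n) : 'M[R]_(k, m) := \matrix_(l, s) e l i s.

Let a1 : \sum_i a 0 i ^+ 2 = 1 := norm2_unit a_unit.

Lemma row_basis_comb (c : 'I_k -> R) (i : 'I_n) :
  row i (\sum_(l < k) c l *: e l) = (\row_l c l) *m E i.
Proof.
apply/rowP => s; rewrite !mxE summxE; apply: eq_bigr => l _.
by rewrite !mxE.
Qed.

Let EET : \sum_i E i *m (E i)^T = 1%:M.
Proof.
have [_ e_on _] := e_onb; apply/matrixP => l l'.
rewrite summxE mxE -e_on /dot; apply: eq_bigr => i _.
by rewrite mxE; apply: eq_bigr => s _; rewrite !mxE.
Qed.

(* [E_i^T E_j] is a block of the orthogonal projection onto [H_a], that is, of
   the identity minus [a^T a] tensored with the identity. *)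
Let ETE i j : (E i)^T *m E j = ((i == j)%:R - a 0 i * a 0 j)%:M.
Proof.
have [e_H e_on e_gen] := e_onb; apply/matrixP => s t.
(* The orthogonal projection to the subspace of the matrix unit at [(i, s)]. Its scalar product with
   [e l] is [e l i s], because [e l] lies in the subspace. *)
pose x : 'M[R]_(n, m) := \matrix_(i', s')
  (((i' == i) && (s' == s))%:R - a 0 i' * (a 0 i * (s' == s)%:R)).
have xH : Hsub m a x.
  apply/rowP => s'; rewrite summxE mxE.
  under eq_bigr do rewrite !mxE mulrBr.
  rewrite sumrB (bigD1 i) //= eqxx big1 => [|i' /negPf ->]; last by rewrite mulr0.
  rewrite [X in _ - X](_ : _
      = (\sum_i' a 0 i' ^+ 2) * (a 0 i * (s' == s)%:R)); last first.
    by rewrite mulr_suml; apply: eq_bigr => i' _; ring.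
  by rewrite a1 mul1r addr0 subrr.
have [c xc] := e_gen x xH.
have cE l : c l = e l i s.
  have -> : c l = dot x (e l).
    rewrite xc /dot.
    transitivity (\sum_(l' < k) c l' * dot (e l') (e l)).
      rewrite (bigD1 l) //= e_on eqxx mulr1 big1 ?addr0 // => l' /negPf ll'.
      by rewrite e_on ll' mulr0.
    under eq_bigr do rewrite mulr_sumr; rewrite exchange_big; apply: eq_bigr => i' _.
    under eq_bigr do rewrite mulr_sumr; rewrite exchange_big; apply: eq_bigr => s' _.
    by rewrite summxE mulr_suml; apply: eq_bigr => l' _; rewrite mxE mulrA.
  have := e_H l => /rowP/(_ s); rewrite summxE mxE => el0.
  have xE i' : \sum_s' x i' s' * e l i' s'
      = (i' == i)%:R * e l i' s - a 0 i * (a 0 i' * e l i' s).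
    rewrite (bigD1 s) //= big1 ?addr0 => [|s' /negPf ss'].
      by rewrite mxE eqxx andbT mulr1; ring.
    by rewrite mxE ss' andbF !mulr0 subr0 mul0r.
  rewrite /dot (eq_bigr _ (fun i' _ => xE i')) sumrB -mulr_sumr.
  rewrite [X in _ - _ * X](_ : _ = 0); last first.
    by rewrite -[RHS]el0; apply: eq_bigr => i' _; rewrite !mxE.
  rewrite mulr0 subr0 (bigD1 i) //= eqxx mul1r big1 ?addr0 // => i' /negPf ->.
  by rewrite mul0r.
have := congr1 (fun y : 'M[R]_(n, m) => y j t) xc.
rewrite !mxE summxE => xjt.
transitivity (\sum_(l < k) (c l *: e l) j t).
  by apply: eq_bigr => l _; rewrite !mxE cE.
rewrite -xjt (eq_sym i j) (eq_sym s t).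
by case: eqP => _; case: eqP => _; rewrite ?mulr1n ?mulr0n ?mulr1 ?mulr0 ?subr0 //=
  mulrC.
Qed.

(** The trace of the sum of the [E i *m (E i)^T] is [k]; taken cyclically it is [m] times the sum of
    [1 - a_i^2], which is [(n - 1) m]. *)
Lemma dim_Hsub : (k + m = n * m)%N.
Proof.
have : \tr (\sum_i E i *m (E i)^T) = k%:R by rewrite EET mxtrace1.
rewrite raddf_sum /=; under eq_bigr do rewrite mxtrace_mulC ETE mxtrace_scalar eqxx.
rewrite sumrMnl sumrB sumr_const card_ord.
under [X in _ - X]eq_bigr do rewrite -expr2.
rewrite a1 => /esym kE; apply/eqP; rewrite -(eqr_nat R) natrD kE natrM.
by rewrite -[(_ - 1) *+ m]mulr_natr mulrBl mul1r subrK.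
Qed.

Section Expectation.
Context (d : measure_display) (T : measurableType d) (P : probability T R).
Variable g : 'I_k -> {RV P >-> R}.
Hypotheses (g_indep : mutually_independent g)
  (g_normal : forall i, standard_normal (g i)).
Variable A : 'I_n -> 'M[R]_m.
Hypotheses (A_sym : forall i, (A i)^T = A i)
  (A_psd : forall i x, 0 <= qform (A i) x).

Let B i := 1%:M + 2 *: A i.

(** In coordinates the exponent is half the difference between the identity form and that of [M],
    the compression of the [B i]; the Gaussian integral gives [\det M], which [det_compression]
    evaluates. *)
Lemma expectation_expR_qform :
  (\int[P]_w (expR (- \sum_(i < n)
      qform (A i) (row i (\sum_(l < k) g l w *: e l))))%:E
   = ((\prod_(i < n) (Num.sqrt (\det (B i)))^-1)
      * (Num.sqrt (\det (\sum_(i < n) a 0 i ^+ 2 *: invmx (B i))))^-1)%:E)%E.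
Proof.
have pB i : posdef (B i).
  split=> [|x x0]; first by rewrite /B linearD linearZ /= trmx1 A_sym.
  by rewrite /B qformD qformZ ltr_wpDr ?mulr_ge0 ?qform1_gt0.
pose M := \sum_i E i *m B i *m (E i)^T.
have qME x : qform M x = qform 1%:M x + 2 * \sum_i qform (A i) (x *m E i).
  rewrite qform_sum; under eq_bigr do rewrite qform_comp qformD qformZ.
  rewrite big_split -mulr_sumr /=; congr (_ + _).
  by rewrite -EET qform_sum; apply: eq_bigr => i _; rewrite -qform_comp mulmx1.
have pM : posdef M.
  split=> [|x x0].
    rewrite linear_sum; apply: eq_bigr => i _ /=.
    by rewrite !trmx_mul trmxK (pB i).1 mulmxA.
  by rewrite qME ltr_wpDr ?qform1_gt0 // mulr_ge0 // sumr_ge0.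
have := expectation_gaussian_quadratic pM g_indep g_normal.
have -> : \det M = (\prod_(i < n) \det (B i))
    * \det (\sum_(i < n) a 0 i ^+ 2 *: invmx (B i)).
  by apply: det_compression => // i; apply: posdef_unit.
have dB i : 0 <= \det (B i) by apply/ltW/posdef_det_gt0.
rewrite sqrtrM ?prodr_ge0 // invfM.
have -> : (Num.sqrt (\prod_(i < n) \det (B i)))^-1
    = \prod_(i < n) (Num.sqrt (\det (B i)))^-1.
  rewrite prodfV; congr (_^-1).
  suff [] : 0 <= \prod_(i < n) \det (B i) /\ Num.sqrt (\prod_(i < n) \det (B i))
    = \prod_(i < n) Num.sqrt (\det (B i)) by [].
  elim/big_rec2: _ => [|i y1 y2 _ [y2_ge0 <-]]; first by rewrite sqrtr1.
  by rewrite mulr_ge0 // sqrtrM.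
move=> <-; apply: eq_integral => w _; rewrite qME; congr (expR _)%:E.
under eq_bigr do rewrite row_basis_comb.
by field.
Qed.

End Expectation.
End GaussianOnSubspace.

(** * Finite Gaussian mixtures *)

Definition possemidef (R : numDomainType) (k : nat) (M : 'M[R]_k) : Prop :=
  M^T = M /\ forall x, 0 <= qform M x.

Definition gaussian_mixture (R : realType) (m : nat) (I : finType) (c : I -> R)
    (A : I -> 'M[R]_m) (x : 'rV[R]_m) : R :=
  \sum_l c l * expR (- qform (A l) x).

(** The expectation of a product of [n] mixtures as a function of the squares [t] of the entries of
    the unit vector; [f] chooses a component of the mixture for each factor. *)
Definition mixture_value (R : realType) (m n : nat) (I : finType) (c : I -> R)
    (A : I -> 'M[R]_m) (t : 'rV[R]_n) : R :=
  \sum_(f : {ffun 'I_n -> I})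
    (\prod_i (c (f i) * (Num.sqrt (\det (1%:M + 2 *: A (f i))))^-1))
    * (Num.sqrt (\det (\sum_i t 0 i *: invmx (1%:M + 2 *: A (f i)))))^-1.

Section MixtureValue.
Context (R : realType) (m n : nat) (I : finType) (c : I -> R)
  (A : I -> 'M[R]_m).
Hypotheses (c_ge0 : forall l, 0 <= c l) (A_psd : forall l, possemidef (A l)).

Let B l := 1%:M + 2 *: A l.

Let pB l : posdef (B l).
Proof.
have [A_sym A_ge0] := A_psd l.
split=> [|x x0]; first by rewrite /B linearD linearZ /= trmx1 A_sym.
by rewrite /B qformD qformZ ltr_wpDr ?mulr_ge0 ?qform1_gt0.
Qed.

Let cB l := c l * (Num.sqrt (\det (B l)))^-1.

Let cB_ge0 l : 0 <= cB l.
Proof. by rewrite mulr_ge0 // invr_ge0 sqrtr_ge0. Qed.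

Context (d : measure_display) (T : measurableType d) (P : probability T R).

Lemma expectation_gaussian_mixture (a : 'rV[R]_n) (G : T -> 'M[R]_(n, m)) :
  norm2 a = 1 -> standard_gaussian P (Hsub m a) G ->
  (\int[P]_w (\prod_(i < n) gaussian_mixture c A (row i (G w)))%:E
    = (mixture_value c A (\row_i a 0 i ^+ 2))%:E)%E.
Proof.
move=> a_unit [k [e [g [e_onb gi gN GE]]]].
have mg l : measurable_fun setT (g l) by exact: measurable_funPT.
have mrow i s : measurable_fun setT (fun w => row i (G w) 0 s).
  under eq_fun do rewrite mxE GE summxE.
  apply: measurable_sum => l; under eq_fun do rewrite mxE.
  by apply: measurable_funM.
have mq (f : {ffun 'I_n -> I}) : measurable_fun setT
    (fun w => expR (- \sum_(i < n) qform (A (f i)) (row i (G w)))).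
  apply: measurableT_comp => //; apply: measurable_funN.
  by apply: measurable_sum => i; exact: measurable_qform.
transitivity (\int[P]_w \sum_(f : {ffun 'I_n -> I}) ((\prod_i c (f i))%:E
    * (expR (- \sum_(i < n) qform (A (f i)) (row i (G w))))%:E))%E.
  apply: eq_integral => w _; rewrite /gaussian_mixture bigA_distr_bigA -sumEFin.
  apply: eq_bigr => f _; rewrite big_split /= -EFinM; congr (_ * _)%:E.
  by rewrite -expR_sum sumrN.
rewrite ge0_integral_sum //; last 2 first.
- move=> f; apply: measurable_funeM; exact/measurable_EFinP.
- by move=> f w _; rewrite -EFinM lee_fin mulr_ge0 ?expR_ge0 // prodr_ge0.
rewrite /mixture_value -sumEFin; apply: eq_bigr => f _.
rewrite ge0_integralZl_EFin ?prodr_ge0 //; last exact/measurable_EFinP.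
under eq_integral do rewrite GE.
rewrite (expectation_expR_qform a_unit e_onb gi gN (A := fun i => A (f i)));
  [|by move=> i; case: (A_psd (f i))..].
rewrite -EFinM mulrA -big_split /=; congr (_ * (Num.sqrt (\det _))^-1)%:E.
by apply: eq_bigr => i _; rewrite mxE.
Qed.

Variable g : 'I_m -> {RV P >-> R}.
Hypotheses (g_indep : mutually_independent g)
  (g_normal : forall i, standard_normal (g i)).

Let integrand (t : 'rV[R]_n) (w : T) : R :=
  expR (2^-1 * qform 1%:M (\row_s g s w))
  * \prod_(i < n) \sum_l cB l
      * expR (- t 0 i * (2^-1 * qform (invmx (B l)) (\row_s g s w))).

Let mg s : measurable_fun setT (fun w => (\row_s g s w : 'rV[R]_m) 0 s).
Proof. under eq_fun do rewrite mxE; exact: measurable_funPT. Qed.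

Let mixture_valueE (t : 'rV[R]_n) : (forall i, 0 <= t 0 i) ->
  \sum_i t 0 i = 1 ->
  (\int[P]_w (integrand t w)%:E = (mixture_value c A t)%:E)%E.
Proof.
move=> t_ge0 t1.
pose M (f : {ffun 'I_n -> I}) := \sum_i t 0 i *: invmx (B (f i)).
have pM f : posdef (M f).
  by apply: posdef_comb; rewrite ?t1 // => i; exact: posdef_inv.
have mf (f : {ffun 'I_n -> I}) : measurable_fun setT (fun w =>
    expR (2^-1 * qform 1%:M (\row_s g s w)
          - 2^-1 * qform (M f) (\row_s g s w))).
  apply: measurableT_comp => //.
  by apply: measurable_funB; apply: measurable_funM => //; exact: measurable_qform.
transitivity (\int[P]_w \sum_(f : {ffun 'I_n -> I}) ((\prod_i cB (f i))%:E
    * (expR (2^-1 * qform 1%:M (\row_s g s w)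
          - 2^-1 * qform (M f) (\row_s g s w)))%:E))%E.
  apply: eq_integral => w _.
  rewrite /integrand bigA_distr_bigA mulr_sumr -sumEFin; apply: eq_bigr => f _.
  rewrite big_split /= -EFinM mulrCA; congr (_ * _)%:E.
  rewrite -expR_sum -expRD /M qform_sum mulr_sumr -sumrN; congr (expR (_ + _)).
  by apply: eq_bigr => i _; rewrite qformZ; ring.
rewrite ge0_integral_sum //; last 2 first.
- move=> f; apply: measurable_funeM; exact/measurable_EFinP.
- by move=> f w _; rewrite -EFinM lee_fin mulr_ge0 ?expR_ge0 // prodr_ge0.
rewrite /mixture_value -sumEFin; apply: eq_bigr => f _.
rewrite ge0_integralZl_EFin ?prodr_ge0 //; last exact/measurable_EFinP.
by rewrite expectation_gaussian_quadratic // -EFinM.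
Qed.

Lemma mixture_value_le (x y : 'rV[R]_n) :
  (forall i, 0 <= x 0 i) -> \sum_i x 0 i = 1 ->
  (forall i, 0 <= y 0 i) -> \sum_i y 0 i = 1 ->
  majorized x y -> mixture_value c A x <= mixture_value c A y.
Proof.
move=> x_ge0 x1 y_ge0 y1 xy.
have mI t : measurable_fun setT (EFin \o integrand t).
  apply/measurable_EFinP; apply: measurable_funM.
    apply: measurableT_comp => //; apply: measurable_funM => //.
    exact: measurable_qform.
  apply: measurable_prod => i _; apply: measurable_sum => l.
  apply: measurable_funM => //; apply: measurableT_comp => //.
  apply: measurable_funM => //; apply: measurable_funM => //.
  exact: measurable_qform.
have I_ge0 t w : 0 <= integrand t w.
  rewrite mulr_ge0 ?expR_ge0 ?prodr_ge0 // => i _; rewrite sumr_ge0 // => l _.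
  by rewrite mulr_ge0 ?expR_ge0.
rewrite -lee_fin -!mixture_valueE //; apply: ge0_le_integral => //.
- by move=> w _; rewrite lee_fin.
- exact: mI.
- exact: mI.
- move=> w _; rewrite lee_fin ler_wpM2l ?expR_ge0 //.
  exact: prod_sum_expR_majorized.
Qed.

End MixtureValue.

(** * Limits of Gaussian mixtures *)

Section GaussianComparison.
Context (R : realType) (m n : nat) (theta phi : 'rV[R]_n).
Hypotheses (n_gt0 : (0 < n)%N)
  (theta_unit : norm2 theta = 1) (phi_unit : norm2 phi = 1)
  (theta_phi : majorized (\row_i theta 0 i ^+ 2) (\row_i phi 0 i ^+ 2)).
Context (d1 : measure_display) (T1 : measurableType d1) (P1 : probability T1 R)
  (G1 : T1 -> 'M[R]_(n, m)).
Hypothesis G1_gauss : standard_gaussian P1 (Hsub m theta) G1.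
Context (d2 : measure_display) (T2 : measurableType d2) (P2 : probability T2 R)
  (G2 : T2 -> 'M[R]_(n, m)).
Hypothesis G2_gauss : standard_gaussian P2 (Hsub m phi) G2.

Lemma expectation_gaussian_mixture_le (I : finType) (c : I -> R)
    (A : I -> 'M[R]_m) :
  (forall l, 0 <= c l) -> (forall l, possemidef (A l)) ->
  (\int[P1]_w (\prod_(i < n) gaussian_mixture c A (row i (G1 w)))%:E
   <= \int[P2]_w (\prod_(i < n) gaussian_mixture c A (row i (G2 w)))%:E)%E.
Proof.
move=> c0 pA; rewrite (expectation_gaussian_mixture c0 pA theta_unit) //.
rewrite (expectation_gaussian_mixture c0 pA phi_unit) // lee_fin.
(* For [n = 1] the subspace is 0 and carries no normal variables to build on; there both squared
   vectors are [(1)]. *)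
case: n n_gt0 theta phi theta_unit phi_unit theta_phi G1 G1_gauss
  => [//|[|n']] _ th ph thu phu thph G G_gauss.
  rewrite (_ : \row_i th 0 i ^+ 2 = \row_i ph 0 i ^+ 2) //.
  apply/rowP => i; have := norm2_unit thu; have := norm2_unit phu.
  by rewrite !big_ord1 !mxE (ord1 i) => -> ->.
have [k [e [g [e_onb gi gN _]]]] := G_gauss.
(* For [n >= 2] the subspace has dimension at least [m], so the first [m] coordinates of [G] serve
   as the auxiliary standard Gaussian on R^m. *)
have mk : (m <= k)%N.
  by rewrite -(leq_add2r m) (dim_Hsub thu e_onb) !mulSn addnA leq_addr.
have wI : injective (widen_ord mk) by move=> s t [] /val_inj.
apply: (mixture_value_le c0 pA (P := P1) (g := g \o widen_ord mk)) => //.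
- exact: sub_mutually_independent.
- by move=> i; exact: gN.
- by move=> i; rewrite mxE sqr_ge0.
- by under eq_bigr do rewrite mxE; exact: norm2_unit.
- by move=> i; rewrite mxE sqr_ge0.
- by under eq_bigr do rewrite mxE; exact: norm2_unit.
Qed.

End GaussianComparison.

(* The closure is inductive because sequential pointwise limits of sequential
   pointwise limits need not be sequential pointwise limits. *)
Inductive mixture_limit (R : realType) (m : nat) : ('rV[R]_m -> R) -> Prop :=
| mixture_limit_finite (I : finType) (c : I -> R) (A : I -> 'M[R]_m) :
    (forall l, 0 <= c l) -> (forall l, possemidef (A l)) ->
    mixture_limit (gaussian_mixture c A)
| mixture_limit_cvg (b : R) (f_ : nat -> 'rV[R]_m -> R) (f : 'rV[R]_m -> R) :
    (forall i, mixture_limit (f_ i)) -> (forall i x, f_ i x <= b) ->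
    (forall x, f_ ^~ x @ \oo --> f x) -> mixture_limit f.

Section MixtureLimits.
Context (R : realType) (m : nat).
Implicit Types f g : 'rV[R]_m -> R.

Lemma mixture_limit_ge0 f : mixture_limit f -> forall x, 0 <= f x.
Proof.
elim=> [I c A c0 _ x|b f_ g _ f_ge0 _ f_g x].
  by apply: sumr_ge0 => l _; rewrite mulr_ge0 ?expR_ge0.
rewrite -(cvg_lim _ (f_g x)) //; apply: limr_ge; first by apply/cvg_ex; exists (g x).
by apply: nearW => i.
Qed.

Lemma mixture_limit_bounded f : mixture_limit f -> exists b, forall x, f x <= b.
Proof.
case=> [I c A c0 pA|b f_ g _ f_b f_g].
  exists (\sum_l c l) => x; apply: ler_sum => l _; rewrite ler_piMr //.
  by rewrite -expR0 ler_expR oppr_le0; case: (pA l).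
exists b => x; rewrite -(cvg_lim _ (f_g x)) //.
apply: limr_le; first by apply/cvg_ex; exists (g x).
by apply: nearW => i.
Qed.

Lemma possemidefD k (M N : 'M[R]_k) :
  possemidef M -> possemidef N -> possemidef (M + N).
Proof.
move=> [sM pM] [sN pN]; split=> [|x]; first by rewrite linearD /= sM sN.
by rewrite qformD addr_ge0.
Qed.

Lemma possemidefZ k (a : R) (M : 'M[R]_k) :
  0 <= a -> possemidef M -> possemidef (a *: M).
Proof.
move=> a0 [sM pM]; split=> [|x]; first by rewrite linearZ /= sM.
by rewrite qformZ mulr_ge0.
Qed.

Lemma mixture_limit_ext f g : f =1 g -> mixture_limit f -> mixture_limit g.
Proof. by move=> /funext ->. Qed.

(** Induction on both factors: exponents add in a product of finite mixtures, and boundedness of the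
    fixed factor keeps the approximating products bounded. *)
Lemma mixture_limitM f g :
  mixture_limit f -> mixture_limit g -> mixture_limit (fun x => f x * g x).
Proof.
move=> fL; elim: fL g => [I c A c0 pA g|b f_ {}f f_L IH f_b f_f g gL].
  elim=> [J c' A' c'0 pA'|b g_ {}g g_L IH g_b g_g].
    apply: (@mixture_limit_ext (gaussian_mixture
      (fun l : I * J => c l.1 * c' l.2) (fun l => A l.1 + A' l.2))).
      move=> x; rewrite /gaussian_mixture mulr_suml -(pair_big_dep xpredT
        (fun=> xpredT) (fun l l' => c l * c' l' * expR (- qform (A l + A' l') x))).
      apply: eq_bigr => l _; rewrite mulr_sumr; apply: eq_bigr => l' _.
      by rewrite qformD opprD expRD mulrACA.
    apply: mixture_limit_finite => l; first by rewrite mulr_ge0.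
    exact: possemidefD.
  have [b' b'P] := mixture_limit_bounded (mixture_limit_finite c0 pA).
  apply: (@mixture_limit_cvg _ _ (b' * b)
    (fun i x => gaussian_mixture c A x * g_ i x)) => // [i x|x].
    apply: ler_pM => //; first exact: mixture_limit_ge0 (mixture_limit_finite c0 pA) x.
    exact: mixture_limit_ge0.
  by apply: cvgM => //; exact: cvg_cst.
have [b' b'P] := mixture_limit_bounded gL.
apply: (@mixture_limit_cvg _ _ (b * b') (fun i x => f_ i x * g x)) => [i|i x|x].
- exact: IH.
- by apply: ler_pM => //; exact: mixture_limit_ge0.
- by apply: cvgM => //; exact: cvg_cst.
Qed.

Lemma mixture_limitD f g :
  mixture_limit f -> mixture_limit g -> mixture_limit (fun x => f x + g x).
Proof.
move=> fL; elim: fL g => [I c A c0 pA g|b f_ {}f f_L IH f_b f_f g gL].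
  elim=> [J c' A' c'0 pA'|b g_ {}g g_L IH g_b g_g].
    apply: (@mixture_limit_ext (gaussian_mixture
      (fun l : I + J => match l with inl i => c i | inr j => c' j end)
      (fun l => match l with inl i => A i | inr j => A' j end))).
      by move=> x; rewrite /gaussian_mixture big_sumType.
    by apply: mixture_limit_finite; case.
  have [b' b'P] := mixture_limit_bounded (mixture_limit_finite c0 pA).
  apply: (@mixture_limit_cvg _ _ (b' + b)
    (fun i x => gaussian_mixture c A x + g_ i x)) => // [i x|x].
    exact: lerD.
  by apply: cvgD => //; exact: cvg_cst.
have [b' b'P] := mixture_limit_bounded gL.
apply: (@mixture_limit_cvg _ _ (b + b') (fun i x => f_ i x + g x)) => [i|i x|x].
- exact: IH.
- exact: lerD.
- by apply: cvgD => //; exact: cvg_cst.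
Qed.

Lemma mixture_limit_expRN (M : 'M[R]_m) :
  possemidef M -> mixture_limit (fun x => expR (- qform M x)).
Proof.
move=> pM; apply: (@mixture_limit_ext
    (gaussian_mixture (fun _ : unit => 1) (fun=> M))); last first.
  exact: mixture_limit_finite.
by move=> x; rewrite /gaussian_mixture big_const /= card_unit /= addr0 mul1r.
Qed.

Lemma mixture_limit_cst (a : R) :
  0 <= a -> mixture_limit (fun _ : 'rV[R]_m => a).
Proof.
move=> a0; apply: (@mixture_limit_ext
    (gaussian_mixture (fun _ : unit => a) (fun=> 0))).
  move=> x; rewrite /gaussian_mixture big_const /= card_unit /= addr0.
  by rewrite /qform mulmx0 mul0mx mxE oppr0 expR0 mulr1.
apply: mixture_limit_finite => // _.
by split=> [|x]; rewrite ?trmx0 // /qform mulmx0 mul0mx mxE.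
Qed.

Lemma mixture_limitX f k :
  mixture_limit f -> mixture_limit (fun x => f x ^+ k).
Proof.
move=> fL; elim: k => [|k IH]; first exact: mixture_limit_cst.
apply: mixture_limit_ext (mixture_limitM fL IH) => x.
by rewrite exprS.
Qed.

(** The partial sums of the exponential series have nonnegative coefficients, so they remain in the
    class, and they increase to the exponential, at most [expR b]. *)
Lemma mixture_limit_expR f :
  mixture_limit f -> mixture_limit (fun x => expR (f x)).
Proof.
move=> fL; have [b fb] := mixture_limit_bounded fL.
have f_ge0 := mixture_limit_ge0 fL.
apply: (@mixture_limit_cvg _ _ (expR b)
  (fun k x => series (exp_coeff (f x)) k)) => [k|k x|x].
- elim: k => [|k IH].
    apply: (@mixture_limit_ext (fun=> 0)); last exact: mixture_limit_cst.
    by move=> x; rewrite /series /= big_geq.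
  have kL : mixture_limit (fun x => f x ^+ k * (k`!%:R)^-1).
    by apply: mixture_limitM; [exact: mixture_limitX|exact: mixture_limit_cst].
  apply: mixture_limit_ext (mixture_limitD IH kL) => x.
  by rewrite /series /= big_nat_recr.
- apply: (@le_trans _ _ (expR (f x))); last by rewrite ler_expR.
  apply: nondecreasing_cvgn_le; last exact: is_cvg_series_exp_coeff.
  apply/nondecreasing_seqP => i; rewrite /series /= big_nat_recr //= lerDl.
  by rewrite /exp_coeff divr_ge0 ?exprn_ge0.
- exact: is_cvg_series_exp_coeff.
Qed.

(** Such [q] may be unbounded: nonnegativity bounds [expR (- q x)] by 1, which makes the class
    stable under all pointwise limits. *)
Definition mixture_exponent (q : 'rV[R]_m -> R) : Prop :=
  (forall x, 0 <= q x) /\ mixture_limit (fun x => expR (- q x)).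

Lemma mixture_exponentD q r : mixture_exponent q -> mixture_exponent r ->
  mixture_exponent (fun x => q x + r x).
Proof.
move=> [q0 qL] [r0 rL]; split=> [x|]; first by rewrite addr_ge0.
by apply: mixture_limit_ext (mixture_limitM qL rL) => x; rewrite opprD expRD.
Qed.

Lemma mixture_exponent0 : mixture_exponent (fun=> 0).
Proof.
split=> //; apply: mixture_limit_cst; exact: expR_ge0.
Qed.

Lemma mixture_exponent_sum (I : Type) (s : seq I) (q : I -> 'rV[R]_m -> R) :
  (forall i, mixture_exponent (q i)) ->
  mixture_exponent (fun x => \sum_(i <- s) q i x).
Proof.
move=> qL; elim: s => [|i s IH].
  by under eq_fun do rewrite big_nil; exact: mixture_exponent0.
by under eq_fun do rewrite big_cons; apply: mixture_exponentD.
Qed.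

Lemma mixture_exponent_cvg (q_ : nat -> 'rV[R]_m -> R) q :
  (forall i, mixture_exponent (q_ i)) -> (forall x, q_ ^~ x @ \oo --> q x) ->
  mixture_exponent q.
Proof.
move=> q_L q_q; split=> [x|].
  rewrite -(cvg_lim _ (q_q x)) //; apply: limr_ge.
    by apply/cvg_ex; exists (q x).
  by apply: nearW => i; case: (q_L i).
apply: (@mixture_limit_cvg _ _ 1 (fun i x => expR (- q_ i x))) => [i|i x|x].
- by case: (q_L i).
- by rewrite -expR0 ler_expR oppr_le0; case: (q_L i).
- by apply: (cvg_comp _ expR); [apply: cvgN; exact: q_q|exact: continuous_expR].
Qed.

Lemma mixture_exponent_qform (M : 'M[R]_m) :
  possemidef M -> mixture_exponent (qform M).
Proof.
by move=> pM; split; [case: pM|exact: mixture_limit_expRN].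
Qed.

(* [exp (- a (1 - G))] is [exp (- a)] times the exponential series in [a G]:
   a compound Poisson mixture. *)
Lemma mixture_exponent_jump (a : R) (M : 'M[R]_m) : 0 <= a -> possemidef M ->
  mixture_exponent (fun x => a * (1 - expR (- qform M x))).
Proof.
move=> a0 pM; split=> [x|].
  by rewrite mulr_ge0 // subr_ge0 -expR0 ler_expR oppr_le0; case: pM.
have eL := mixture_limit_expR
  (mixture_limitM (mixture_limit_cst a0) (mixture_limit_expRN pM)).
apply: mixture_limit_ext (mixture_limitM (mixture_limit_cst (expR_ge0 (- a))) eL).
by move=> x; rewrite -expRD; congr expR; ring.
Qed.

End MixtureLimits.

(** * Fractional powers from a discretized Bernstein integral *)

Section GeometricBernsteinSum.
Variables (R : realType) (alpha h : R).
Hypotheses (alpha_gt0 : 0 < alpha) (alpha_lt1 : alpha < 1) (h_gt0 : 0 < h).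

(* The integral of [t^(-1 - alpha) (1 - exp (- t s))], a multiple of
   [s^alpha], discretized at the points [t = exp (k h)] for all integers [k].
   The discrete sum is multiplied by [exp (alpha h)] when [s] is by [exp h]; as
   it increases with [s], it is [s^alpha] up to a constant and a factor between
   [exp (- alpha h)] and [exp (alpha h)]. *)
Definition bernstein_term (s x : R) : R :=
  expR (- (alpha * x)) * (1 - expR (- (expR x * s))).

Let a := bernstein_term.

(** The nodes are [j h] for [- n <= j < n]: those from 0 upwards and those from [- h] downwards are
    paired. *)
Definition bernstein_sum (s : R) (n : nat) : R :=
  \sum_(0 <= k < n) (a s (k%:R * h) + a s (- (k.+1%:R * h))).

Let a_ge0 s x : 0 <= s -> 0 <= a s x.
Proof.
move=> s0; rewrite mulr_ge0 ?expR_ge0 // subr_ge0 -expR0 ler_expR oppr_le0.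
by rewrite mulr_ge0 ?expR_ge0.
Qed.

Let a_le s t x : s <= t -> a s x <= a t x.
Proof.
move=> st; apply: ler_wpM2l; first exact: expR_ge0.
by rewrite lerD2l lerN2 ler_expR lerN2 ler_wpM2l ?expR_ge0.
Qed.

Let a_shift s x : a (expR h * s) x = expR (alpha * h) * a s (x + h).
Proof.
rewrite /a /bernstein_term mulrA -expRD mulrA -expRD; congr (expR _ * _).
by ring.
Qed.

(** Ratios of the geometric series dominating the terms: [rho] at nonnegative nodes, where
    [1 - exp (- u) <= 1] is used, and [rho'] at negative ones, where [1 - exp (- u) <= u] is. *)
Let rho : R := expR (- (alpha * h)).
Let rho' : R := expR (- ((1 - alpha) * h)).

Let rho_lt1 : rho < 1.
Proof. by rewrite -expR0 ltr_expR oppr_lt0 mulr_gt0. Qed.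

Let rho'_lt1 : rho' < 1.
Proof. by rewrite -expR0 ltr_expR oppr_lt0 mulr_gt0 // subr_gt0. Qed.

Let a_pos_le s k : 0 <= s -> a s (k%:R * h) <= rho ^+ k.
Proof.
move=> s0; rewrite /rho -expRM_natl mulrN mulrCA.
by rewrite ler_piMr ?expR_ge0 // lerBlDr lerDl expR_ge0.
Qed.

Let a_neg_le s k : 0 <= s -> a s (- (k%:R * h)) <= s * rho' ^+ k.
Proof.
move=> s0; rewrite /rho' -expRM_natl.
have -> : s * expR (k%:R * - ((1 - alpha) * h))
    = expR (- (alpha * (- (k%:R * h)))) * (expR (- (k%:R * h)) * s).
  by rewrite mulrA -expRD [RHS]mulrC; congr (_ * expR _); ring.
apply: ler_wpM2l; first exact: expR_ge0.
by have := expR_ge1Dx (- (expR (- (k%:R * h)) * s)); lra.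
Qed.

Let geometric_le (q : R) n : 0 < q -> q < 1 ->
  \sum_(0 <= k < n) q ^+ k <= (1 - q)^-1.
Proof.
move=> q0 q1; have q10 : 0 < 1 - q by rewrite subr_gt0.
rewrite -[leRHS]mul1r ler_pdivlMr // mulrC.
have -> : (1 - q) * \sum_(0 <= k < n) q ^+ k = 1 - q ^+ n.
  elim: n => [|n IH]; first by rewrite big_geq // mulr0 expr0 subrr.
  by rewrite big_nat_recr //= mulrDr IH exprS; ring.
by rewrite lerBlDr lerDl exprn_ge0 // ltW.
Qed.

Lemma bernstein_sum_nd s : 0 <= s -> nondecreasing_seq (bernstein_sum s).
Proof.
move=> s0; apply/nondecreasing_seqP => n.
by rewrite /bernstein_sum big_nat_recr //= lerDl addr_ge0 ?a_ge0.
Qed.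

Lemma is_cvg_bernstein_sum s : 0 <= s -> cvgn (bernstein_sum s).
Proof.
move=> s0; apply: nondecreasing_is_cvgn; first exact: bernstein_sum_nd.
exists ((1 - rho)^-1 + s * (1 - rho')^-1) => _ [n _ <-].
rewrite /bernstein_sum big_split /=; apply: lerD.
  apply: le_trans (geometric_le n (expR_gt0 _) rho_lt1).
  by apply: ler_sum => k _; exact: a_pos_le.
apply: (@le_trans _ _ (s * \sum_(0 <= k < n) rho' ^+ k)).
  rewrite mulr_sumr; apply: ler_sum => k _; apply: le_trans (a_neg_le _ s0) _.
  (* The negative nodes start at [- h], so one surplus factor [rho'] is bounded by 1. *)
  by rewrite ler_wpM2l // exprS ler_piMl ?exprn_ge0 ?expR_ge0 // ltW.
by rewrite ler_wpM2l // geometric_le // expR_gt0.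
Qed.

Definition bernstein_series (s : R) : R := limn (bernstein_sum s).

Let S := bernstein_series.

Let S_le s t : 0 <= s -> s <= t -> S s <= S t.
Proof.
move=> s0 st; have t0 := le_trans s0 st.
apply: ler_lim; [exact: is_cvg_bernstein_sum..|].
by apply: nearW => n; apply: ler_sum => k _; rewrite lerD ?a_le.
Qed.

Lemma bernstein_series_gt0 : 0 < S 1.
Proof.
apply: (@lt_le_trans _ _ (bernstein_sum 1 1)); last first.
  by apply: nondecreasing_cvgn_le; [exact: bernstein_sum_nd|exact: is_cvg_bernstein_sum].
rewrite /bernstein_sum big_nat1 ltr_pwDl ?a_ge0 // mul0r /a /bernstein_term.
by rewrite mulr0 oppr0 !expR0 !mul1r subr_gt0 -[ltRHS]expR0 ltr_expR oppr_lt0.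
Qed.

Lemma bernstein_series0 : S 0 = 0.
Proof.
rewrite /S /bernstein_series (_ : bernstein_sum 0 = cst 0) ?lim_cst //.
apply/funext => n; rewrite /bernstein_sum big1 // => k _.
by rewrite /a /bernstein_term !mulr0 !oppr0 expR0 subrr !mulr0 addr0.
Qed.

Let geometric_cvg0 (q : R) : 0 < q -> q < 1 -> q ^+ n @[n --> \oo] --> 0.
Proof. by move=> q0 q1; apply: cvg_expr; rewrite gtr0_norm. Qed.

(** Scaling [s] by [expR h] moves every node by one step; a truncated sum then changes by two end
    terms, which tend to 0. *)
Let S_shift1 s : 0 <= s -> S (expR h * s) = expR (alpha * h) * S s.
Proof.
move=> s0.
have sumE n : bernstein_sum (expR h * s) n = expR (alpha * h)
    * (bernstein_sum s n + a s (n%:R * h) - a s (- (n%:R * h))).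
  rewrite /bernstein_sum; elim: n => [|n IH].
    by rewrite !big_geq // mul0r oppr0 add0r subrr mulr0.
  rewrite !big_nat_recr //= IH !a_shift.
  have -> : n%:R * h + h = n.+1%:R * h by rewrite -natr1; ring.
  have -> : - (n.+1%:R * h) + h = - (n%:R * h) by rewrite -natr1; ring.
  by ring.
have cvg0 (u v : nat -> R) : (forall n, 0 <= u n <= v n) ->
    v n @[n --> \oo] --> 0 -> u n @[n --> \oo] --> 0.
  by move=> uv v0; apply: (@squeeze_cvgr _ _ _ _ (cst 0) v) => //;
    [exact: nearW|exact: cvg_cst].
have c1 : a s (n%:R * h) @[n --> \oo] --> 0.
  apply: (cvg0 _ (fun n => rho ^+ n)) => [n|]; first by rewrite a_ge0 ?a_pos_le.
  by apply: geometric_cvg0 => //; exact: expR_gt0.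
have c2 : a s (- (n%:R * h)) @[n --> \oo] --> 0.
  apply: (cvg0 _ (fun n => s * rho' ^+ n)) => [n|]; first by rewrite a_ge0 ?a_neg_le.
  rewrite -[0](mulr0 s); apply: cvgM; first exact: cvg_cst.
  by apply: geometric_cvg0 => //; exact: expR_gt0.
apply/cvg_lim => //; rewrite (funext sumE).
apply: cvgM; first exact: cvg_cst.
rewrite -[S s]addr0 -[_ + 0]subr0; apply: cvgB => //; apply: cvgD => //.
exact: is_cvg_bernstein_sum.
Qed.

Let S_shift k s :
  0 <= s -> S (expR (k%:R * h) * s) = expR (alpha * (k%:R * h)) * S s.
Proof.
move=> s0; elim: k => [|k IH]; first by rewrite !mul0r mulr0 expR0 !mul1r.
have -> : k.+1%:R * h = h + k%:R * h by rewrite -natr1; ring.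
rewrite expRD -mulrA S_shift1 ?mulr_ge0 ?expR_ge0 // IH mulrA -expRD.
by rewrite mulrDr.
Qed.

(** For [y >= 0], compare with the last multiple of [h] not above [y], where the shift rule is
    exact. Other [y] are first moved up by a multiple of [h], and the common factor is cancelled. *)
Lemma bernstein_series_ge (y : R) :
  expR (alpha * (y - h)) * S 1 <= S (expR y).
Proof.
have le_S x : 0 <= x -> expR (alpha * (x - h)) * S 1 <= S (expR x).
  move=> x0; have /andP[kx xk] := truncn_itv (divr_ge0 x0 (ltW h_gt0)).
  move: kx xk; set k := Num.truncn _; rewrite ler_pdivlMr // ltr_pdivrMr // => kx xk.
  apply: (@le_trans _ _ (S (expR (k%:R * h)))); last first.
    by rewrite S_le ?expR_ge0 // ler_expR.
  rewrite -[X in _ <= S X]mulr1 S_shift //; apply: ler_wpM2r.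
    exact/ltW/bernstein_series_gt0.
  rewrite ler_expR ler_pM2l //; move: xk; rewrite -natr1; lra.
pose k := (Num.truncn (`|y| / h)).+1.
have ky : 0 <= y + k%:R * h.
  have := truncnS_gt (`|y| / h); rewrite -/k ltr_pdivrMr // => yk.
  by have := ler_norm (- y); rewrite normrN; lra.
have := le_S _ ky.
rewrite (addrC y) expRD S_shift ?expR_ge0 // -addrA mulrDr expRD -mulrA.
by rewrite ler_pM2l ?expR_gt0.
Qed.

Lemma bernstein_series_le (y : R) :
  S (expR y) <= expR (alpha * (y + h)) * S 1.
Proof.
have S_le' x : 0 <= x -> S (expR x) <= expR (alpha * (x + h)) * S 1.
  move=> x0; have /andP[kx xk] := truncn_itv (divr_ge0 x0 (ltW h_gt0)).
  move: kx xk; set k := Num.truncn _; rewrite ler_pdivlMr // ltr_pdivrMr // => kx xk.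
  apply: (@le_trans _ _ (S (expR (k.+1%:R * h)))).
    by rewrite S_le ?expR_ge0 // ler_expR ltW.
  rewrite -[X in S X <= _]mulr1 S_shift //; apply: ler_wpM2r.
    exact/ltW/bernstein_series_gt0.
  by rewrite ler_expR ler_pM2l // -natr1; lra.
pose k := (Num.truncn (`|y| / h)).+1.
have ky : 0 <= y + k%:R * h.
  have := truncnS_gt (`|y| / h); rewrite -/k ltr_pdivrMr // => yk.
  by have := ler_norm (- y); rewrite normrN; lra.
have := S_le' _ ky.
rewrite (addrC y) expRD S_shift ?expR_ge0 // -addrA mulrDr expRD -mulrA.
by rewrite ler_pM2l ?expR_gt0.
Qed.

End GeometricBernsteinSum.

(** Dividing by the value at 1 removes the unknown constant; the ratio lies within factors
    [exp (- alpha h)] and [exp (alpha h)] of the power, with mesh [h = n.+1%:R^-1]. The case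
    [s = 0], without logarithm, is separate. *)
Lemma cvg_bernstein_ratio (R : realType) (alpha s : R) :
  0 < alpha -> alpha < 1 -> 0 <= s ->
  bernstein_series alpha n.+1%:R^-1 s / bernstein_series alpha n.+1%:R^-1 1
    @[n --> \oo] --> s `^ alpha.
Proof.
move=> a0 a1; rewrite le_eqVlt => /predU1P[<-|s0].
  rewrite powR0 ?gt_eqF //; under eq_fun do rewrite bernstein_series0 mul0r.
  exact: cvg_cst.
have h0 n : 0 < n.+1%:R^-1 :> R by rewrite invr_gt0.
have hcvg : n.+1%:R^-1 @[n --> \oo] --> (0 : R) by exact: cvg_harmonic.
have -> : s `^ alpha = expR (alpha * ln s) by rewrite /powR gt_eqF.
apply: (@squeeze_cvgr _ _ _ _
  (fun n => expR (alpha * (ln s - n.+1%:R^-1)))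
  (fun n => expR (alpha * (ln s + n.+1%:R^-1)))).
- apply: nearW => n; have S1 := bernstein_series_gt0 a0 a1 (h0 n).
  rewrite ler_pdivlMr // ler_pdivrMr // -{2 3}(lnK s0).
  by rewrite bernstein_series_ge ?bernstein_series_le.
- apply: (cvg_comp _ expR); last exact: continuous_expR.
  apply: cvgM; first exact: cvg_cst.
  by rewrite -[X in _ --> X]subr0; apply: cvgB => //; exact: cvg_cst.
- apply: (cvg_comp _ expR); last exact: continuous_expR.
  apply: cvgM; first exact: cvg_cst.
  by rewrite -[X in _ --> X]addr0; apply: cvgD => //; exact: cvg_cst.
Qed.

(** For [alpha < 1] two limits are nested: the mesh tends to 0 with [j] and, for each mesh, the
    truncation grows with [n]. Each term is a jump exponent for the form scaled by [expR y]. *)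
Lemma mixture_exponent_powR (R : realType) (m : nat) (alpha b : R)
    (M : 'M[R]_m) : 0 < alpha -> alpha <= 1 -> 0 <= b -> possemidef M ->
  mixture_exponent (fun x => b * (qform M x) `^ alpha).
Proof.
move=> a0; rewrite le_eqVlt => /predU1P[->|a1] b0 pM.
  under eq_fun do rewrite powRr1 ?pM.2 // -qformZ.
  exact/mixture_exponent_qform/possemidefZ.
have h0 n : 0 < n.+1%:R^-1 :> R by rewrite invr_gt0.
pose S j s := bernstein_series alpha j.+1%:R^-1 s.
apply: (@mixture_exponent_cvg _ _ (fun j x =>
    (b / S j 1) * S j (qform M x))) => [j|x]; last first.
  under eq_fun do rewrite -mulrA (mulrC _^-1).
  by apply: cvgM; [exact: cvg_cst|apply: cvg_bernstein_ratio => //; case: pM].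
apply: (@mixture_exponent_cvg _ _ (fun n x => (b / S j 1)
    * bernstein_sum alpha j.+1%:R^-1 (qform M x) n)) => [n|x]; last first.
  apply: cvgM; first exact: cvg_cst.
  by apply: is_cvg_bernstein_sum => //; case: pM.
have S1 : 0 <= b / S j 1 by rewrite divr_ge0 // ltW // bernstein_series_gt0.
under eq_fun do rewrite /bernstein_sum mulr_sumr.
have term y : mixture_exponent (fun x => b / S j 1 * bernstein_term alpha (qform M x) y).
  rewrite /bernstein_term.
  under eq_fun do rewrite mulrA -qformZ.
  by apply: mixture_exponent_jump; [rewrite mulr_ge0 ?expR_ge0|
    apply: possemidefZ => //; exact: expR_ge0].
apply: mixture_exponent_sum => i; under eq_fun do rewrite mulrDr.
exact: mixture_exponentD.
Qed.

Lemma measurable_mixture_limit (R : realType) (m : nat) (f : 'rV[R]_m -> R)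
    d (T : measurableType d) (Z : T -> 'rV[R]_m) :
  (forall i, measurable_fun setT (fun w => Z w 0 i)) ->
  mixture_limit f -> measurable_fun setT (fun w => f (Z w)).
Proof.
move=> mZ; elim=> [I c A c0 pA|b f_ {}f _ mf_ _ f_f].
  apply: measurable_sum => l; apply: measurable_funM => //.
  apply: measurableT_comp => //; apply: measurable_funN.
  exact: measurable_qform.
by apply: (measurable_fun_cvg mf_) => w _; exact: f_f.
Qed.

Lemma expectation_mixture_limit_cvg (R : realType) (m n : nat) (b : R)
    (f_ : nat -> 'rV[R]_m -> R) (f : 'rV[R]_m -> R)
    d (T : measurableType d) (P : probability T R) (G : T -> 'M[R]_(n, m)) :
  (forall i s, measurable_fun setT (fun w => row i (G w) 0 s)) ->
  (forall k, mixture_limit (f_ k)) -> (forall k x, f_ k x <= b) ->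
  (forall x, f_ ^~ x @ \oo --> f x) ->
  (\int[P]_w (\prod_(i < n) f_ k (row i (G w)))%:E @[k --> \oo]
    --> \int[P]_w (\prod_(i < n) f (row i (G w)))%:E)%E.
Proof.
move=> mG f_L f_b f_f.
have fL := mixture_limit_cvg f_L f_b f_f.
have mprod (g : 'rV[R]_m -> R) : mixture_limit g ->
    measurable_fun setT (fun w => \prod_(i < n) g (row i (G w))).
  by move=> gL; apply: measurable_prod => i _; exact: measurable_mixture_limit.
pose F k w := (\prod_(i < n) f_ k (row i (G w)))%:E.
pose Finf w := (\prod_(i < n) f (row i (G w)))%:E.
have mF k : measurable_fun setT (F k) by apply/measurable_EFinP; exact: mprod.
have mFinf : measurable_fun setT Finf by apply/measurable_EFinP; exact: mprod.
have F_cvg : {ae P, forall w, setT w -> F ^~ w @ \oo --> Finf w}.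
  apply: aeW => w _; apply: cvg_EFin; first exact: nearW.
  apply: cvg_big => [|i _]; first exact: mul_continuous.
  exact: f_f.
have b_int : P.-integrable setT (cst (b ^+ n)%:E).
  exact: finite_measure_integrable_cst.
have F_le : {ae P, forall w k, setT w -> (`|F k w| <= cst (b ^+ n)%:E w)%E}.
  apply: aeW => w k _; rewrite abse_EFin lee_fin ger0_norm; last first.
    by rewrite prodr_ge0 // => i _; exact: mixture_limit_ge0.
  rewrite -[X in b ^+ X]card_ord -prodr_const; apply: ler_prod => i _.
  by rewrite mixture_limit_ge0 //= f_b.
by have [_ _] := dominated_convergence measurableT mF mFinf F_cvg b_int F_le.
Qed.

Lemma measurable_standard_gaussian (R : realType) (m n : nat)
    (H : set 'M[R]_(n, m)) d (T : measurableType d) (P : probability T R)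
    (G : T -> 'M[R]_(n, m)) : standard_gaussian P H G ->
  forall i s, measurable_fun setT (fun w => row i (G w) 0 s).
Proof.
move=> [k [e [g [_ _ _ GE]]]] i s.
under eq_fun do rewrite mxE GE summxE.
apply: measurable_sum => l; under eq_fun do rewrite mxE.
by apply: measurable_funM => //; exact: measurable_funPT.
Qed.

Section MixtureLimitComparison.
Context (R : realType) (m n : nat) (theta phi : 'rV[R]_n).
Hypotheses (n_gt0 : (0 < n)%N)
  (theta_unit : norm2 theta = 1) (phi_unit : norm2 phi = 1)
  (theta_phi : majorized (\row_i theta 0 i ^+ 2) (\row_i phi 0 i ^+ 2)).
Context (d1 : measure_display) (T1 : measurableType d1) (P1 : probability T1 R)
  (G1 : T1 -> 'M[R]_(n, m)).
Hypothesis G1_gauss : standard_gaussian P1 (Hsub m theta) G1.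
Context (d2 : measure_display) (T2 : measurableType d2) (P2 : probability T2 R)
  (G2 : T2 -> 'M[R]_(n, m)).
Hypothesis G2_gauss : standard_gaussian P2 (Hsub m phi) G2.

(** Induction along the closure: the inequality holds for finite mixtures, and dominated convergence
    with constant [b ^+ n] carries it to limits. *)
Lemma expectation_mixture_limit_le (f : 'rV[R]_m -> R) : mixture_limit f ->
  (\int[P1]_w (\prod_(i < n) f (row i (G1 w)))%:E
   <= \int[P2]_w (\prod_(i < n) f (row i (G2 w)))%:E)%E.
Proof.
have mG1 := measurable_standard_gaussian G1_gauss.
have mG2 := measurable_standard_gaussian G2_gauss.
elim=> [I c A c0 pA|b f_ {}f f_L IH f_b f_f].
  exact: (expectation_gaussian_mixture_le n_gt0 theta_unit phi_unit).
have c1 := expectation_mixture_limit_cvg (P := P1) mG1 f_L f_b f_f.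
have c2 := expectation_mixture_limit_cvg (P := P2) mG2 f_L f_b f_f.
rewrite -(cvg_lim _ c1) // -(cvg_lim _ c2) //; apply: lee_lim.
- by apply/cvg_ex; eexists; exact: c1.
- by apply/cvg_ex; eexists; exact: c2.
- by apply: nearW => k; exact: IH.
Qed.

End MixtureLimitComparison.

(** * The exponent of the norm *)

Lemma cvg_powR (R : realType) (p l : R) (u : nat -> R) : 0 < p ->
  (forall n, 0 <= u n) -> u n @[n --> \oo] --> l ->
  u n `^ p @[n --> \oo] --> l `^ p.
Proof.
move=> p0 u0 ul.
have : 0 <= l.
  rewrite -(cvg_lim _ ul) //; apply: limr_ge; last exact: nearW.
  by apply/cvg_ex; exists l.
rewrite le_eqVlt => /predU1P[l0|l0].
  rewrite -l0 powR0 ?gt_eqF //; rewrite -l0 in ul.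
  apply/cvgr0Pnorm_lt => e e0.
  have u_lt := (cvgr0Pnorm_lt _).1 ul (e `^ p^-1) (powR_gt0 _ e0).
  near=> n; have : `|u n| < e `^ p^-1 by near: n; exact: u_lt.
  rewrite !ger0_norm ?powR_ge0 // => un.
  have := gt0_ltr_powR p0 (u0 n) (powR_ge0 _ _) un.
  by rewrite -powRrM mulVf ?gt_eqF // powRr1 // ltW.
have -> : l `^ p = expR (p * ln l) by rewrite /powR gt_eqF.
have : (fun n => expR (p * ln (u n))) @ \oo --> expR (p * ln l).
  apply: (cvg_comp _ expR); last exact: continuous_expR.
  apply: cvgM; first exact: cvg_cst.
  by apply: (cvg_comp _ (@ln R)); [exact: ul|exact: continuous_ln].
apply: cvg_trans; apply: near_eq_cvg.
near=> n; have un : 0 < u n by near: n; exact: cvgr_gt l ul _ l0.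
by rewrite /powR gt_eqF.
Unshelve. all: by end_near.
Qed.

Lemma measurable_borelRV_coord (R : realType) (m : nat) (i : 'I_m) :
  measurable_fun setT (fun u : borelRV R m => (u : 'rV[R]_m) 0 i).
Proof.
apply: (measurability _ (RGenOpens.measurableE R)) => _ [_ [a [b ->]] <-].
rewrite setTI; apply: sub_sigma_algebra.
have /continuousP : continuous (fun M : 'rV[R]_m => M 0 i) by exact: coord_continuous.
by apply; exact: interval_open.
Qed.

(** * Discretization of the measure on the sphere *)

Section SphereDiscretization.
Context (R : realType) (m : nat) (mu : {measure set (borelRV R m) -> \bar R}).
Hypothesis mu_iso : isotropic mu.

Let S : set (borelRV R m) := sphere R m.

Let dotE (x u : 'rV[R]_m) : dot x u = \sum_j x 0 j * u 0 j.
Proof. by rewrite /dot big_ord1. Qed.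

Lemma measurable_dot (x : 'rV[R]_m) :
  measurable_fun setT (fun u : borelRV R m => dot x u).
Proof.
under eq_fun do rewrite dotE; apply: measurable_sum => j.
by apply: measurable_funM => //; exact: measurable_borelRV_coord.
Qed.

Lemma measurable_sphere : measurable S.
Proof.
have -> : S = (fun u : borelRV R m => \sum_j (u : 'rV[R]_m) 0 j ^+ 2) @^-1` [set 1].
  apply/seteqP; split=> u /=; first exact: norm2_unit.
  move=> u1; rewrite /S /sphere /= /norm2 dotE.
  by under eq_bigr do rewrite -expr2; rewrite u1 sqrtr1.
have msq : measurable_fun setT
    (fun u : borelRV R m => \sum_j (u : 'rV[R]_m) 0 j ^+ 2).
  apply: measurable_sum => j; apply: measurable_funX.
  exact: measurable_borelRV_coord.
by rewrite -[X in measurable X]setTI; exact: msq.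
Qed.

(** Isotropy at the basis vectors gives each squared coordinate the integral 1, and these squares
    add up to 1 on the sphere; the total mass is thus [m]. *)
Lemma isotropic_sphere_lty : (mu S < +oo)%E.
Proof.
have coord1 i : (\int[mu]_(u in S) (((u : 'rV[R]_m) 0 i) ^+ 2)%:E = 1)%E.
  have dot_delta (u : 'rV[R]_m) : dot (delta_mx 0 i) u = u 0 i.
    rewrite dotE (bigD1 i) //= big1 => [|j /negPf ji]; last by rewrite mxE ji mul0r.
    by rewrite mxE !eqxx mul1r addr0.
  have := mu_iso (delta_mx 0 i).
  rewrite /norm2 dot_delta mxE !eqxx sqrtr1.
  rewrite (eq_integral (fun u : borelRV R m => (((u : 'rV[R]_m) 0 i) ^+ 2)%:E));
    last by move=> u _; rewrite dot_delta.
  have : (0 <= \int[mu]_(u in S) (((u : 'rV[R]_m) 0 i) ^+ 2)%:E)%E.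
    by apply: integral_ge0 => u _; rewrite lee_fin sqr_ge0.
  rewrite -/S; case: (integral _ _ _) => [r| |] //=.
    rewrite lee_fin => r0 [] /(congr1 (fun y => y ^+ 2)).
    by rewrite powR12_sqrt // sqr_sqrtr // expr1n => <-.
  (* An infinite integral has an infinite root, as the exponent is not 0; only at exponent 0 would
     the power be 1. *)
  by rewrite invr_eq0 pnatr_eq0.
have mS := measurable_sphere.
have -> : mu S = (\int[mu]_(u in S) 1)%E by rewrite integral_cst // mul1e.
have -> : (\int[mu]_(u in S) 1
    = \int[mu]_(u in S) \sum_i (((u : 'rV[R]_m) 0 i) ^+ 2)%:E)%E.
  by apply: eq_integral => u /set_mem uS; rewrite sumEFin norm2_unit.
rewrite ge0_integral_sum //.
- by under eq_bigr do rewrite coord1; rewrite sumEFin ltry.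
- move=> i; apply/measurable_EFinP/measurable_funTS; apply: measurable_funX.
  exact: measurable_borelRV_coord.
- by move=> i u _; rewrite lee_fin sqr_ge0.
Qed.

Variable N : nat.

(** A grid of mesh [N.+1%:R^-1] on the cube of side [[-1, 1]]. Cells are half-open, so the
    coordinate 1 needs the extra index [2 * N.+1]. *)
Let idx : finType := {ffun 'I_m -> 'I_(2 * N.+1).+1}.

Definition grid_node (z : {ffun 'I_m -> 'I_(2 * N.+1).+1}) : 'rV[R]_m :=
  \row_i ((z i)%:R / N.+1%:R - 1).

Definition grid_cell (z : {ffun 'I_m -> 'I_(2 * N.+1).+1}) (u : 'rV[R]_m) : R :=
  \prod_i \1_(`[(z i)%:R, (z i).+1%:R[) ((u 0 i + 1) * N.+1%:R).

Definition grid_round (u : 'rV[R]_m) : 'rV[R]_m :=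
  \row_i ((Num.truncn ((u 0 i + 1) * N.+1%:R))%:R / N.+1%:R - 1).

Lemma sphere_coord_itv (u : 'rV[R]_m) i :
  S u -> 0 <= (u 0 i + 1) * N.+1%:R <= (2 * N.+1)%:R.
Proof.
move=> /norm2_unit; rewrite (bigD1 i) //= => u1.
have u_le1 : u 0 i ^+ 2 <= 1.
  by rewrite -u1 lerDl sumr_ge0 // => j _; rewrite sqr_ge0.
have : `|u 0 i| <= 1 by rewrite -(expr_le1 (n := 2)) // real_normK ?num_real.
rewrite ler_norml => /andP[u_ge u_le]; apply/andP; split.
  by rewrite mulr_ge0 // -lerBlDr sub0r.
by rewrite natrM ler_pM2r ?ltr0n // (natrD _ 1 1) lerD2r.
Qed.

Lemma grid_round_itv (u : 'rV[R]_m) i : S u -> `|grid_round u 0 i| <= 1.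
Proof.
move=> uS; have /andP[ge0 le2] := sphere_coord_itv i uS.
have /andP[tr_le _] := truncn_itv ge0; have := le_trans tr_le le2.
rewrite mxE natrM -ler_pdivrMr ?ltr0n //; set t := (_ / _) => t_le2.
have t_ge0 : 0 <= t by rewrite divr_ge0.
by rewrite ler_norml; apply/andP; split; lra.
Qed.

Lemma grid_round_near (u : 'rV[R]_m) i :
  S u -> `|u 0 i - grid_round u 0 i| <= N.+1%:R^-1.
Proof.
move=> uS; have /andP[ge0 _] := sphere_coord_itv i uS.
have /andP[] := truncn_itv ge0; rewrite mxE.
set t := Num.truncn _; rewrite -ler_pdivrMr ?ltr0n // => h1.
rewrite -ltr_pdivlMr ?ltr0n // -(natr1 t) mulrDl mul1r => h2.
have N_ge0 : 0 <= N.+1%:R^-1 :> R by rewrite invr_ge0.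
move: h1 h2 N_ge0; move: (_ / _) => q; move: (_^-1) => r h1 h2 r_ge0.
by rewrite ler_norml; apply/andP; split; lra.
Qed.

(** A point of the sphere lies in exactly one cell, the one whose node is its rounding. *)
Lemma grid_cell_sum (h : 'rV[R]_m -> R) (u : 'rV[R]_m) : S u ->
  \sum_z grid_cell z u * h (grid_node z) = h (grid_round u).
Proof.
move=> uS.
have cellE (z : idx) i : \1_(`[(z i)%:R, (z i).+1%:R[) ((u 0 i + 1) * N.+1%:R)
    = (Num.truncn ((u 0 i + 1) * N.+1%:R) == z i)%:R :> R.
  have /andP[ge0 _] := sphere_coord_itv i uS.
  by rewrite truncn_eq // indicE mem_setE in_itv.
have tr_lt i : (Num.truncn ((u 0 i + 1) * N.+1%:R)%R < (2 * N.+1).+1)%N.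
  have /andP[ge0 le2] := sphere_coord_itv i uS.
  by rewrite ltnS -(ler_nat R) (le_trans _ le2) //; have /andP[] := truncn_itv ge0.
pose z0 : idx := [ffun i => Ordinal (tr_lt i)].
rewrite (bigD1 z0) //= big1 => [|z zz0].
  rewrite addr0 /grid_cell big1 => [|i _]; last by rewrite cellE ffunE eqxx.
  by rewrite mul1r; congr h; apply/rowP => i; rewrite !mxE ffunE.
have [i zi] : exists i, z i != z0 i.
  apply/existsP; apply: contraR zz0; rewrite negb_exists => /forallP zE.
  by apply/eqP/ffunP => i; apply/eqP; have := zE i; rewrite negbK.
rewrite /grid_cell (bigD1 i) //= cellE; move: zi.
by rewrite -val_eqE ffunE /= eq_sym => /negPf ->; rewrite !mul0r.
Qed.

Lemma grid_cell_ge0 z u : 0 <= grid_cell z u.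
Proof. by rewrite prodr_ge0. Qed.

Lemma measurable_grid_cell z :
  measurable_fun setT (fun u : borelRV R m => grid_cell z u).
Proof.
apply: measurable_prod => i _.
have m1 : measurable_fun setT (\1_(`[(z i)%:R, (z i).+1%:R[) : R -> R).
  exact: measurable_indic.
apply: (measurableT_comp m1).
apply: measurable_funM => //; apply: measurable_funD => //.
exact: measurable_borelRV_coord.
Qed.

Definition grid_weight (z : {ffun 'I_m -> 'I_(2 * N.+1).+1}) : R :=
  fine (\int[mu]_(u in S) (grid_cell z u)%:E)%E.

Lemma grid_weight_ge0 z : 0 <= grid_weight z.
Proof.
by apply/fine_ge0/integral_ge0 => u _; rewrite lee_fin grid_cell_ge0.
Qed.

Lemma integral_grid_round (h : 'rV[R]_m -> R) : (forall v, 0 <= h v) ->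
  (\int[mu]_(u in S) (h (grid_round u))%:E
    = (\sum_z grid_weight z * h (grid_node z))%:E)%E.
Proof.
move=> h0; have mS := measurable_sphere.
transitivity (\int[mu]_(u in S)
    \sum_z ((h (grid_node z))%:E * (grid_cell z u)%:E))%E.
  apply: eq_integral => u /set_mem uS; rewrite -grid_cell_sum // -sumEFin.
  by apply: eq_bigr => z _; rewrite -EFinM mulrC.
have mcell z : measurable_fun S (fun u => (grid_cell z u)%:E).
  by apply/measurable_EFinP/measurable_funTS; exact: measurable_grid_cell.
rewrite ge0_integral_sum //; last 2 first.
- by move=> z; exact: measurable_funeM.
- by move=> z u _; rewrite -EFinM lee_fin mulr_ge0 // grid_cell_ge0.
rewrite -sumEFin; apply: eq_bigr => z _.
rewrite ge0_integralZl_EFin //; last first.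
  by move=> u _; rewrite lee_fin grid_cell_ge0.
rewrite EFinM muleC; congr (_ * _)%E; rewrite /grid_weight fineK //.
rewrite ge0_fin_numE; last first.
  by apply: integral_ge0 => u _; rewrite lee_fin grid_cell_ge0.
apply: le_lt_trans isotropic_sphere_lty.
rewrite -[leRHS]mul1e -integral_cst //; apply: ge0_le_integral => //.
- by move=> u _; rewrite lee_fin grid_cell_ge0.
- move=> u _; rewrite lee_fin.
  apply: prodr_ile1 => i _.
  by rewrite indicE; case: (_ \in _); rewrite /= ?lexx ?ler01.
Qed.

End SphereDiscretization.

(** The integrand is the power [p / 2], in [(0, 1]], of the rank-one form of [u], hence an exponent
    for each [u]. Rounding [u] to the grid turns the integral into finite sums of these, which
    converge by domination. *)
Lemma mixture_exponent_Xnorm (R : realType) (m : nat) (p lambda : R)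
    (mu : {measure set (borelRV R m) -> \bar R}) :
  isotropic mu -> 0 < p -> p <= 2 -> 0 < lambda ->
  mixture_exponent (fun x : 'rV[R]_m => lambda
    * fine (\int[mu]_(u in sphere R m) (`|dot x u| `^ p)%:E)%E).
Proof.
move=> mu_iso p_gt0 p_le2 lambda_gt0.
pose h (x v : 'rV[R]_m) : R := `|dot x v| `^ p.
have h_ge0 x v : 0 <= h x v by exact: powR_ge0.
have dotE (x u : 'rV[R]_m) : dot x u = \sum_j x 0 j * u 0 j.
  by rewrite /dot big_ord1.
have hE x v : h x v = (qform (v^T *m v) x) `^ (p / 2).
  rewrite qform_outer (_ : (x *m v^T) 0 0 = dot x v); last first.
    by rewrite dotE mxE; apply: eq_bigr => j _; rewrite mxE.
  rewrite -real_normK ?num_real // -powR_mulrn // -powRrM /h.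
  by congr (_ `^ _); field.
apply: (@mixture_exponent_cvg _ _ (fun N x =>
    \sum_z lambda * (grid_weight mu z * h x (@grid_node R m N z)))) => [N|x].
  apply: mixture_exponent_sum => z; under eq_fun do rewrite mulrA hE.
  apply: mixture_exponent_powR.
  - by rewrite divr_gt0.
  - by rewrite ler_pdivrMr // mul1r.
  - by rewrite mulr_ge0 ?grid_weight_ge0 // ltW.
  - split=> [|y]; first by rewrite trmx_mul trmxK.
    by rewrite qform_outer sqr_ge0.
under eq_fun do rewrite -mulr_sumr.
apply: cvgM; first exact: cvg_cst.
have mS := @measurable_sphere R m.
pose S : set (borelRV R m) := sphere R m.
have mh : measurable_fun setT (fun u : borelRV R m => h x u).
  apply: (measurableT_comp (measurable_powR p)).
  apply: measurableT_comp => //; exact: measurable_dot.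
(* Rounded points have coordinates in [[-1, 1]], so [b] dominates for every mesh; it is integrable
   because the sphere has finite mass. *)
pose b : R := (\sum_j `|x 0 j|) `^ p.
have b_int : mu.-integrable S (cst b%:E).
  apply/integrableP; split; first exact: measurable_cst.
  rewrite (eq_integral (cst b%:E)); last first.
    by move=> u _; rewrite /= ger0_norm ?powR_ge0.
  by rewrite integral_cst // lte_mul_pinfty ?lee_fin ?powR_ge0 // isotropic_sphere_lty.
have round_le N (u : 'rV[R]_m) : S u -> h x (grid_round N u) <= b.
  move=> uS; have dot_le : `|dot x (grid_round N u)| <= \sum_j `|x 0 j|.
    rewrite dotE; apply: le_trans (ler_norm_sum _ _ _) _; apply: ler_sum => j _.
    by rewrite normrM ler_piMr // grid_round_itv.
  by apply: ge0_ler_powR dot_le; rewrite ?nnegrE ?sumr_ge0 // ltW.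
have round_cvg (u : 'rV[R]_m) : S u -> h x (grid_round N u) @[N --> \oo] --> h x u.
  move=> uS; apply: cvg_powR => //; apply: cvg_norm.
  rewrite dotE; under eq_fun do rewrite dotE.
  apply: cvg_big => [|j _]; first exact: add_continuous.
  apply: cvgM; first exact: cvg_cst.
  apply/cvgrPdist_le => e e0.
  have he := (cvgr0Pnorm_le _).1 (@cvg_harmonic R) e e0.
  near=> N; apply: le_trans (grid_round_near N j uS) _.
  have : `|@harmonic R N| <= e by near: N; exact: he.
  by rewrite ger0_norm // invr_ge0.
have m_round N : measurable_fun S (fun u => (h x (grid_round N u))%:E).
  apply: (eq_measurable_fun (fun u : borelRV R m =>
      (\sum_z grid_cell z u * h x (@grid_node R m N z))%:E)).
    by move=> u /set_mem uS; rewrite grid_cell_sum.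
  apply/measurable_EFinP/measurable_funTS; apply: measurable_sum => z.
  by apply: measurable_funM => //; exact: measurable_grid_cell.
have mh_S : measurable_fun S (fun u => (h x u)%:E).
  by apply/measurable_EFinP/measurable_funTS.
have aecvg : {ae mu, forall u, S u ->
    (h x (grid_round N u))%:E @[N --> \oo] --> (h x u)%:E}.
  apply: aeW => u uS; apply: cvg_EFin; first exact: nearW.
  exact: round_cvg.
have aele : {ae mu, forall u N, S u ->
    (`|(h x (grid_round N u))%:E| <= cst b%:E u)%E}.
  apply: aeW => u N uS; rewrite abse_EFin lee_fin ger0_norm //.
  exact: round_le.
have [hint _ hcvg] := dominated_convergence mS m_round mh_S aecvg b_int aele.
rewrite (_ : (fun N => _) = fine \o (fun N =>
    \int[mu]_(u in S) (h x (grid_round N u))%:E)%E); last first.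
  by apply/funext => N; rewrite /= integral_grid_round.
apply: fine_cvg; rewrite fineK; first exact: hcvg.
exact: integrable_fin_num.
Unshelve. all: by end_near.
Qed.

(** The power [p] undoes both roots, so the exponential of the norm splits into one factor per
    row. *)
Lemma lpnorm_Xnorm (R : realType) (m n : nat) (p : R)
    (mu : {measure set (borelRV R m) -> \bar R}) (x : 'M[R]_(n, m)) : 0 < p ->
  lpnorm p (Xnorm p mu) x `^ p
    = \sum_(i < n) fine (\int[mu]_(u in sphere R m) (`|dot (row i x) u| `^ p)%:E)%E.
Proof.
move=> p_gt0; have root t : 0 <= t -> (t `^ p^-1) `^ p = t :> R.
  by move=> t0; rewrite -powRrM mulVf ?gt_eqF // powRr1.
rewrite /lpnorm root; last by apply: sumr_ge0 => i _; exact: powR_ge0.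
apply: eq_bigr => i _; rewrite /Xnorm root //.
by apply/fine_ge0/integral_ge0 => u _; rewrite lee_fin powR_ge0.
Qed.

Theorem theorem5 (R : realType) (m n : nat) (m_gt0 : (0 < m)%N)
    (n_gt0 : (0 < n)%N) (p : R) (p_gt0 : 0 < p) (p_le2 : p <= 2)
    (mu : {measure set (borelRV R m) -> \bar R})
    (mu_sphere : on_sphere mu) (mu_iso : isotropic mu)
    (lambda : R) (lambda_gt0 : 0 < lambda)
    (theta phi : 'rV[R]_n)
    (theta_unit : norm2 theta = 1) (phi_unit : norm2 phi = 1)
    (d1 : measure_display) (T1 : measurableType d1) (P1 : probability T1 R)
    (Gtheta : T1 -> 'M[R]_(n, m))
    (Gtheta_gauss : standard_gaussian P1 (Hsub m theta) Gtheta)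
    (d2 : measure_display) (T2 : measurableType d2) (P2 : probability T2 R)
    (Gphi : T2 -> 'M[R]_(n, m))
    (Gphi_gauss : standard_gaussian P2 (Hsub m phi) Gphi) :
  majorized (\row_(i < n) (theta 0 i) ^+ 2) (\row_(i < n) (phi 0 i) ^+ 2) ->
  ('E_P1[fun w => expR (- lambda * (lpnorm p (Xnorm p mu) (Gtheta w)) `^ p)%R]
   <= 'E_P2[fun w => expR (- lambda * (lpnorm p (Xnorm p mu) (Gphi w)) `^ p)%R])%E.
Proof.
move=> theta_phi.
pose q (x : 'rV[R]_m) : R := lambda
  * fine (\int[mu]_(u in sphere R m) (`|dot x u| `^ p)%:E)%E.
have [_ qL] : mixture_exponent q by exact: mixture_exponent_Xnorm.
have expE (x : 'M[R]_(n, m)) :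
    expR (- lambda * (lpnorm p (Xnorm p mu) x) `^ p)
    = \prod_(i < n) expR (- q (row i x)).
  by rewrite lpnorm_Xnorm // -expR_sum sumrN -mulr_sumr mulNr.
rewrite unlock; under eq_integral do rewrite expE.
under [leRHS]eq_integral do rewrite expE.
exact: (expectation_mixture_limit_le n_gt0 theta_unit phi_unit theta_phi
  Gtheta_gauss Gphi_gauss qL).
Qed.
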